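(* Let $A=[A_1,\ldots,A_n]$ and $B=[B_1,\ldots,B_n]$ be in $[B(\mathcal H)^n]_1^-$ and let $V=[V_1,\ldots,V_n]$ on $\mathcal K_A=\mathcal H\oplus[F^2(H_n)\otimes\mathcal D_{A^*}]$ and $W=[W_1,\ldots,W_n]$ on $\mathcal K_B=\mathcal H\oplus[F^2(H_n)\otimes\mathcal D_{B^*}]$ be the minimal isometric dilations of $A$ and $B$, respectively. Then $A\overset{H}{\prec}B$ if and only if there exist two bounded linear operators $\Omega_0:\mathcal H\to\mathcal D_{B^*}$ and $\Theta_0:\mathcal D_{A^*}\to\mathcal D_{B^*}$ such that the following conditions are satisfied: (i) $\Delta_{B^*}\Omega_0=\begin{bmatrix}A_1^*-B_1^*\\ \vdots\\ A_n^*-B_n^*\end{bmatrix}$; (ii) the map $\Omega:\mathcal H\to F^2(H_n)\otimes\mathcal D_{B^*}$ defined by $$\Omega h:=(I_{F^2(H_n)}\otimes\Omega_0)\sum_{k=0}^\infty\Bigl(\sum_{j=1}^nR_j\otimes A_j^*\Bigr)^k(1\otimes h)=\sum_{\alpha\in\mathbb F_n^+}e_\alpha\otimes\Omega_0A_\alpha^*h$$ is a bounded operator; (iii) $\Delta_{A^*}=\Delta_{B^*}\Theta_0$ (as operators on $\mathcal D_{A^*}$); (iv) the formal series $$I_{F^2(H_n)}\otimes\Theta_0+(I_{F^2(H_n)}\otimes\Omega_0)\Bigl(I-\sum_{j=1}^nR_j\otimes A_j^*\Bigr)^{-1}[R_1\otimes I_{\mathcal H},\ldots,R_n\otimes I_{\mathcal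 H}](I_{F^2(H_n)}\otimes\Delta_{A^*})$$ is the Fourier representation of a multi-analytic operator $\Theta:F^2(H_n)\otimes\mathcal D_{A^*}\to F^2(H_n)\otimes\mathcal D_{B^*}$. In this case the operator $L_{B,A}:\mathcal K_B\to\mathcal K_A$ satisfying $L_{B,A}|_{\mathcal H}=I_{\mathcal H}$ and $L_{B,A}W_i=V_iL_{B,A}$, $i=1,\ldots,n$, is given by $$L_{B,A}^*=\begin{bmatrix}I_{\mathcal H}&0\\ \Omega&\Theta\end{bmatrix}.$$
   Context: $n$ is a positive integer, $\mathcal H$ is a complex Hilbert space, and $B(\mathcal H)$ is the algebra of bounded linear operators on $\mathcal H$. $[B(\mathcal H)^n]_1^-$ (resp. $[B(\mathcal H)^n]_1$) is the set of $(X_1,\ldots,X_n)\in B(\mathcal H)^n$ with $\|X_1X_1^*+\cdots+X_nX_n^*\|^{1/2}\le 1$ (resp. $<1$). Harnack domination: for $A,B\in[B(\mathcal H)^n]_1^-$, $A\overset{H}{\prec}B$ means that there is $c>0$ with $\mathrm{Re}\,p(A)\le c^2\,\mathrm{Re}\,p(B)$ for every $m\in\mathbb N$ and every noncommutative polynomial with matrix coefficients $p\in\mathbb C[X_1,\ldots,X_n]\otimes M_m$ such that $\mathrm{Re}\,p(X)\ge0$ for all $X\in[B(\mathcal K)^n]_1$, where $\mathcal K$ is an infinite-dimensional Hilbert space ($\mathrm{Re}\,T=\frac12(T+T^* )$). $\mathbb F_n^+$ is the unital free semigroup on generators $g_1,\ldots,g_n$ with identity $g_0$. For $\alpha=g_{i_1}\cdots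 g_{i_k}$: $A_\alpha:=A_{i_1}\cdots A_{i_k}$, $A_{g_0}:=I$, $A_\alpha^*:=(A_\alpha)^*$, $e_\alpha:=e_{i_1}\otimes\cdots\otimes e_{i_k}$, $e_{g_0}:=1$, and $\tilde\alpha:=g_{i_k}\cdots g_{i_1}$. $F^2(H_n)=\mathbb C1\oplus\bigoplus_{k\ge1}H_n^{\otimes k}$ is the full Fock space of an $n$-dimensional Hilbert space $H_n$ with orthonormal basis $e_1,\ldots,e_n$; $S_i\varphi:=e_i\otimes\varphi$ and $R_i\varphi:=\varphi\otimes e_i$ are the left and right creation operators. Defect operators and spaces of a row contraction $T\in[B(\mathcal H)^n]_1^-$: $\Delta_{T^*}:=([\delta_{ij}I_{\mathcal H}-T_i^*T_j]_{n\times n})^{1/2}\in B(\mathcal H^{(n)})$, $\mathcal D_{T^*}:=\overline{\Delta_{T^*}\mathcal H^{(n)}}$, where $\mathcal H^{(n)}$ is the direct sum of $n$ copies of $\mathcal H$. For $i=1,\ldots,n$, $D_{T^*,i}:\mathcal H\to F^2(H_n)\otimes\mathcal D_{T^*}$ is $D_{T^*,i}h:=1\otimes\Delta_{T^*}(0,\ldots,0,h,0,\ldots,0)$ ($h$ in the $i$-th place). The minimal isometric dilation of $T$ is realized on $\mathcal K_T:=\mathcal H\oplus[F^2(H_n)\otimes\mathcal D_{T^*}]$ by $$(h\oplus\xi)\mapsto T_ih\oplus[D_{T^*,i}h+(S_i\otimes I_{\mathcal D_{T^*}})\xi],\qquad i=1,\ldots,n.$$ The operators $V_i$ (for $T=A$)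 and $W_i$ (for $T=B$) are these operators, and the matrix of $L_{B,A}^*:\mathcal K_A\to\mathcal K_B$ is with respect to these decompositions. A bounded operator $M:F^2(H_n)\otimes\mathcal E\to F^2(H_n)\otimes\mathcal G$ is multi-analytic if $M(S_i\otimes I_{\mathcal E})=(S_i\otimes I_{\mathcal G})M$ for all $i$. Its (formal) Fourier representation is $\sum_{\alpha\in\mathbb F_n^+}R_\alpha\otimes\theta_{(\alpha)}$, where $\theta_{(\alpha)}\in B(\mathcal E,\mathcal G)$ is given by $\langle\theta_{(\tilde\alpha)}x,y\rangle:=\langle M(1\otimes x),e_\alpha\otimes y\rangle$; it determines $M$ uniquely. In (iv), the inverse is expanded formally as $\sum_{k\ge0}(\sum_jR_j\otimes A_j^* )^k$, and $[R_1\otimes I,\ldots,R_n\otimes I](I\otimes\Delta_{A^*})=\sum_iR_i\otimes P_i\Delta_{A^*}|_{\mathcal D_{A^*}}$, with $P_i:\mathcal H^{(n)}\to\mathcal H$ the projection on the $i$-th component. *)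

(* Defs.v *)
From HB Require Import structures.
From mathcomp Require Import all_boot all_order all_algebra finmap complex.
From mathcomp Require Import ring.
From mathcomp Require Import all_classical all_reals.
From mathcomp Require Import topology normedtype sequences.
From mathcomp.analysis.showcase Require summability.

Set Implicit Arguments.
Unset Strict Implicit.
Unset Printing Implicit Defensive.

Import Order.TTheory GRing.Theory Num.Theory.
Import numFieldNormedType.Exports.
Local Open Scope classical_set_scope.
Local Open Scope ring_scope.

#[global] Existing Instance summability.totally_filter.

(* The library's Cauchy-Schwarz inequality is for finite-dimensional spaces. *)
Lemma dot_CauchySchwarz (C : numClosedFieldType) (U : lmodType C)
    (f : {dot U for (@Num.conj C)}) (u v : U) :
  `|f u v| ^+ 2 <= f u u * f v v.
Proof.
have [->|v0] := eqVneq v 0; first by rewrite !linear0r normr0 expr0n mulr0.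
have fv : 0 < f v v by rewrite dnorm_gt0.
have fvn0 : f v v != 0 by rewrite gt_eqF.
have := dnorm_ge0 f (f v v *: u - f u v *: v).
have cv : (f v v)^* = f v v by apply: conj_Creal; rewrite ger0_real// ltW.
have vu : f v u = (f u v)^* by rewrite hermC /= expr0 mul1r.
rewrite linearBr !linearBl /= !linearZlr /= vu cv.
set a := f v v; set b := f u v; set d := f u u.
have -> : a * (a * d) - b * (a * b^*) - (a * (b^* * b) - b * (b^* * a)) =
          a * (d * a - b * b^*) by ring.
by rewrite pmulr_rge0// subr_ge0 normCK.
Qed.

Definition hnorm (C : numClosedFieldType) (U : lmodType C)
  (f : {dot U for (@Num.conj C)}) (u : U) : C := sqrtC (f u u).

Section hnorm.
Variables (C : numClosedFieldType) (U : lmodType C).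
Variable f : {dot U for (@Num.conj C)}.

Lemma hnormD (u v : U) : hnorm f (u + v) <= hnorm f u + hnorm f v.
Proof.
rewrite /hnorm -ler_sqr ?nnegrE ?addr_ge0 ?sqrt_dnorm_ge0//.
rewrite sqrrD !sqrtCK addrAC dnormD lerD2l.
rewrite -mulr_natr -[leLHS](divfK (negbT (pnatr_eq0 C 2))).
rewrite ler_pM2r ?ltr0n// -ReE// (le_trans (leif_Re_Creal _).1)//.
rewrite -ler_sqr ?nnegrE ?mulr_ge0 ?sqrt_dnorm_ge0// exprMn !sqrtCK.
exact: dot_CauchySchwarz.
Qed.

Lemma hnormZ (l : C) (u : U) : hnorm f (l *: u) = `|l| * hnorm f u.
Proof. by rewrite /hnorm dnormZ sqrtCM ?qualifE/= ?exprn_ge0 ?dnorm_ge0// sqrCK. Qed.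

Lemma hnorm_eq0 (u : U) : hnorm f u = 0 -> u = 0.
Proof. by move/eqP; rewrite sqrt_dnorm_eq0 => /eqP. Qed.
End hnorm.

(* [{dot H for Num.conj}] is linear in the first argument; the norm, like every
   norm of a normed module over [R[i]], takes its values in [R[i]]. *)
HB.mixin Record NormedModule_hasInner (R : realType) H of NormedModule R[i] H := {
  inner : {dot H for (@Num.conj R[i])} ;
  normE : forall x : H, `|x| = sqrtC (inner x x)
}.

#[short(type="preHilbertType")]
HB.structure Definition PreHilbert (R : realType) :=
  {H of NormedModule R[i] H & NormedModule_hasInner R H}.

#[short(type="hilbertType")]
HB.structure Definition Hilbert (R : realType) :=
  {H of PreHilbert R H & Complete H}.

HB.factory Record Lmodule_hasInner (R : realType) H of GRing.Lmodule R[i] H := {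
  inner : {dot H for (@Num.conj R[i])}
}.
HB.builders Context R H of Lmodule_hasInner R H.
HB.instance Definition _ := @Lmodule_isNormed.Build R[i] H (hnorm inner)
  (@hnormD _ _ inner) (@hnormZ _ _ inner) (@hnorm_eq0 _ _ inner).
HB.instance Definition _ := @NormedModule_hasInner.Build R H inner
  (fun=> erefl).
HB.end.

Section bop.
Variable (C : numFieldType).

Definition bounded_op (V W : normedModType C) (f : V -> W) : Prop :=
  linear f /\ exists M : C, forall x, `|f x| <= M * `|x|.

Section type.
Variables V W : normedModType C.

Definition bounded_op_pred : {pred V -> W} := fun f => `[< bounded_op f >].

Record bop := Bop { bop_fun :> V -> W ; _ : bop_fun \in bounded_op_pred }.
HB.instance Definition _ := [isSub for bop_fun].
HB.instance Definition _ := [Choice of bop by <:].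

Lemma bounded_op_submod : submod_closed bounded_op_pred.
Proof.
split=> [|a f g /asboolP[lf [M fM]] /asboolP[lg [N gN]]]; apply/asboolP; split.
- by move=> a x y; rewrite -[LHS]/(0 : W) -[RHS]/(a *: (0 : W) + 0) scaler0 addr0.
- by exists 0 => x; rewrite -[X in `|X|]/(0 : W) normr0 mul0r.
- move=> b x y; rewrite !fctE lf lg !scalerDr !scalerA [b * a]mulrC.
  by rewrite addrACA.
exists (`|a| * M + N) => x; rewrite !fctE (le_trans (ler_normD _ _))//.
by rewrite mulrDl lerD// normrZ -mulrA ler_wpM2l.
Qed.
HB.instance Definition _ := GRing.isSubmodClosed.Build _ _ bounded_op_pred bounded_op_submod.
HB.instance Definition _ := [SubChoice_isSubLmodule of bop by <:].

Lemma bopP (f : bop) : bounded_op f.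
Proof. by case: f => f /= /asboolP. Qed.

HB.instance Definition _ (f : bop) :=
  GRing.isLinear.Build C V W *:%R f (proj1 (bopP f)).

Definition mkbop (f : V -> W) (h : bounded_op f) : bop := Bop (asboolT h).
End type.

Lemma id_bounded (V : normedModType C) : bounded_op (@idfun V).
Proof. by split=> [a x y//|]; exists 1 => x; rewrite mul1r. Qed.

Lemma comp_bounded (U V W : normedModType C) (g : bop V W) (f : bop U V) :
  bounded_op (g \o f).
Proof.
split=> [a x y|]; first by rewrite /= !linearP.
have [_ [M gM]] := bopP g; have [_ [N fN]] := bopP f.
have pos (X Y : normedModType C) (a : C) (x : X) (y : Y) :
    `|y| <= a * `|x| -> `|y| <= `|a| * `|x|.
  have [->|x0] := eqVneq x 0; first by rewrite normr0 !mulr0.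
  move=> yx; rewrite ger0_norm//; have := le_trans (normr_ge0 y) yx.
  by rewrite pmulr_lge0// normr_gt0.
exists (`|M| * `|N|) => x /=; rewrite (le_trans (pos _ _ _ _ _ (gM (f x))))//.
by rewrite -mulrA ler_wpM2l//; exact: pos.
Qed.

Definition idop V : bop V V := mkbop (@id_bounded V).
Definition compop U V W (g : bop V W) (f : bop U V) : bop U W :=
  mkbop (comp_bounded g f).
End bop.

Section sums.
Variables (R : realType) (I : choiceType).
Implicit Types (A B : {fset I}) (u : I -> R[i]).
Local Notation C := R[i].

(* The limit of the partial sums along the finite subsets of [I]. *)
Definition usum u : C := @summability.sum I C C^o u.

Definition psum u : {fset I} -> C^o := fun A => \sum_(i <- A) u i.

Lemma psumE u : @summability.partial_sum I C^o u = psum u.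
Proof.
by apply/funext => A; rewrite /summability.partial_sum /psum big_seq_fsetE.
Qed.

Lemma psum_ge0 u A : (forall i, 0 <= u i) -> 0 <= psum u A.
Proof. by move=> u0; apply: sumr_ge0. Qed.

Lemma psum_le u A B : (forall i, 0 <= u i) -> (A `<=` B)%fset ->
  psum u A <= psum u B.
Proof.
move=> u0 AB; rewrite /psum (big_fsetID _ (mem A) B)/=.
have -> : [fset x in B | x \in A]%fset = A.
  by apply/fsetP => x; rewrite !inE andbC; case: (boolP (x \in A)) => // /(fsubsetP AB).
by rewrite lerDl sumr_ge0.
Qed.

Lemma psum_cvg_ge0 u (M : C) : (forall i, 0 <= u i) ->
  (forall A, psum u A <= M) ->
  exists s, [/\ psum u @ summability.totally --> (s : C^o),
     (forall A, psum u A <= s) & s <= M].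
Proof.
move=> u0 uM.
have uRe A : psum u A = (complex.Re (psum u A))%:C%C :> C.
  by rewrite RRe_real// ger0_real// psum_ge0.
have M0 : 0 <= M by rewrite (le_trans _ (uM fset0))// psum_ge0.
have MRe : M = (complex.Re M)%:C%C by rewrite RRe_real// ger0_real.
pose S := range (fun A => complex.Re (psum u A)).
have supS : has_sup S.
  split; first by exists (complex.Re (psum u fset0)), fset0.
  by exists (complex.Re M) => _ [A _ <-]; have := uM A; rewrite uRe MRe lecR.
exists (sup S)%:C%C; split.
- apply/cvgrPdist_lt => e e0.
  have eRe : e = (complex.Re e)%:C%C by rewrite RRe_real// gtr0_real.
  have e0' : 0 < complex.Re e by move: e0; rewrite eRe ltcR.
  have [_ [A _ <-] SA] := sup_adherent e0' supS.
  exists A => //= B AB.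
  rewrite [psum u B]uRe -rmorphB normc_def/= expr0n addr0 sqrtr_sqr eRe ltcR.
  rewrite ger0_norm ?subr_ge0; last by apply: sup_upper_bound => //; exists B.
  rewrite ltrBlDr -ltrBlDl (lt_le_trans SA)// -lecR -!uRe.
  exact: psum_le.
- by move=> A; rewrite uRe lecR; apply: sup_upper_bound => //; exists A.
- rewrite MRe lecR; apply: ge_sup; first by case: supS.
  by move=> _ [A _ <-]; have := uM A; rewrite uRe MRe lecR.
Qed.

Lemma usumP u (s : C) : psum u @ summability.totally --> (s : C^o) -> usum u = s.
Proof. by rewrite /usum /summability.sum psumE; exact: cvg_lim. Qed.

Lemma cvg_lin (F : set_system {fset I}) {FF : Filter F} (k a b : C)
    (u v : {fset I} -> C^o) :
  u @ F --> (a : C^o) -> v @ F --> (b : C^o) ->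
  (fun A => k * u A + v A : C^o) @ F --> (k * a + b : C^o).
Proof.
move=> ua vb; have h := @cvgZl_tmp C C^o _ F FF k u a ua.
exact: (@cvgD C C^o _ F FF (k \*: u) v (k *: a) b h vb).
Qed.
Lemma cvg_seqsum T (F : set_system T) {FF : Filter F} (s : seq I)
    (f : I -> T -> C^o) (l : I -> C^o) :
  (forall i, f i @ F --> l i) ->
  (fun t => \sum_(i <- s) f i t) @ F --> \sum_(i <- s) l i.
Proof.
move=> fl; elim: s => [|i s IHs].
  under eq_fun do rewrite big_nil.
  by rewrite big_nil; exact: cvg_cst.
under eq_fun do rewrite big_cons.
rewrite big_cons.
exact: (@cvgD C C^o _ F FF (f i) (fun t => \sum_(i <- s) f i t) (l i) _ (fl i) IHs).
Qed.

End sums.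
Arguments cvg_lin {R I F FF} k [a b u v].

Section square_summable.
Variables (R : realType) (I : choiceType) (E : preHilbertType R).
Local Notation C := R[i].

Definition square_summable (f : I -> E) : Prop :=
  exists M : C, forall A : {fset I}, \sum_(i <- A) `|f i| ^+ 2 <= M.

Definition square_summable_pred : {pred I -> E} :=
  fun f => `[< square_summable f >].

(* The Hilbert direct sum of [I] copies of [E]; for a finite [I] this is the
   usual [E^I], every family being square-summable. *)
Record ell2 := Ell2 {
  ell2_fun :> I -> E ; _ : ell2_fun \in square_summable_pred }.
HB.instance Definition _ := [isSub for ell2_fun].
HB.instance Definition _ := [Choice of ell2 by <:].

Lemma normsqE (x : E) : `|x| ^+ 2 = inner x x.
Proof. by rewrite normE sqrtCK. Qed.

Lemma parallelogram (x y : E) :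
  `|x + y| ^+ 2 + `|x - y| ^+ 2 = 2%:R * (`|x| ^+ 2 + `|y| ^+ 2).
Proof. rewrite !normsqE dnormB dnormD; ring. Qed.

Lemma polarization (x y : E) : inner x y = 4%:R^-1 *
  (`|x + y| ^+ 2 - `|x - y| ^+ 2 +
   'i * `|x + 'i *: y| ^+ 2 - 'i * `|x - 'i *: y| ^+ 2).
Proof.
have xiy : inner x ('i *: y) = - 'i * inner x y by rewrite linearZr_LR/= conjCi.
rewrite !normsqE !dnormB !dnormD xiy rmorphM rmorphN/= conjCi opprK.
have := sqrCi C; set j := Num.imaginary; set a := inner x y.
set b := a^*; set c := inner x x; set d := inner y y.
set e := inner ('i *: y) ('i *: y); move=> j2.
have -> : c + d + (a + b) - (c + d - (a + b)) +
  j * (c + e + (- j * a + j * b)) - j * (c + e - (- j * a + j * b)) =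
  2%:R * a + 2%:R * b + (j ^+ 2) * (2%:R * b - 2%:R * a) by ring.
by rewrite j2; field.
Qed.

Lemma square_summable_submod : submod_closed square_summable_pred.
Proof.
split=> [|a f g /asboolP[M fM] /asboolP[N gN]]; apply/asboolP.
  by exists 0 => A; rewrite big1// => i _; rewrite -[X in `|X|]/(0 : E) normr0 expr0n.
exists (2%:R * (`|a| ^+ 2 * M + N)) => A.
apply: (@le_trans _ _ (\sum_(i <- A) 2%:R * (`|a| ^+ 2 * `|f i| ^+ 2 + `|g i| ^+ 2))).
  apply: ler_sum => i _; rewrite -exprMn -normrZ -parallelogram lerDl.
  by rewrite exprn_ge0.
rewrite -mulr_sumr big_split/= -mulr_sumr ler_wpM2l// lerD// ler_wpM2l//.
by rewrite exprn_ge0.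
Qed.
HB.instance Definition _ :=
  GRing.isSubmodClosed.Build _ _ square_summable_pred square_summable_submod.
HB.instance Definition _ := [SubChoice_isSubLmodule of ell2 by <:].

Lemma ell2P (f : ell2) : square_summable f.
Proof. by case: f => f /= /asboolP. Qed.

Lemma ell2_cvg (f : ell2) : exists s : C,
  [/\ psum (fun i => `|f i| ^+ 2) @ summability.totally --> (s : C^o),
    (forall A, psum (fun i => `|f i| ^+ 2) A <= s) &
    forall M, (forall A, psum (fun i => `|f i| ^+ 2) A <= M) -> s <= M].
Proof.
have [M fM] := ell2P f.
have f0 i : 0 <= `|f i| ^+ 2 by rewrite exprn_ge0.
have [s [sf fs _]] := psum_cvg_ge0 f0 fM.
exists s; split=> // N fN; have [t [tf _ tN]] := psum_cvg_ge0 f0 fN.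
by rewrite -(usumP sf) (usumP tf).
Qed.

Definition ell2_inner (f g : ell2) : C := usum (fun i => inner (f i) (g i)).

Lemma ell2_inner_cvg (f g : ell2) :
  psum (fun i => inner (f i) (g i)) @ summability.totally
    --> (ell2_inner f g : C^o).
Proof.
have [s1 [h1 _ _]] := ell2_cvg (f + g).
have [s2 [h2 _ _]] := ell2_cvg (f - g).
have [s3 [h3 _ _]] := ell2_cvg (f + 'i *: g).
have [s4 [h4 _ _]] := ell2_cvg (f - 'i *: g).
have TF : Filter (@summability.totally I) by exact: filter_filter.
have c0 : (fun=> 0 : C^o) @ @summability.totally I --> (0 : C^o) by exact: cvg_cst.
have h := cvg_lin (FF := TF) (4%:R^-1) (cvg_lin (FF := TF) (- 'i) h4 (cvg_lin (FF := TF) 'i h3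
  (cvg_lin (FF := TF) (-1) h2 h1))) c0.
set t := (X in X @ _ --> _).
suff tc : t = (fun A => 4%:R^-1 * (- 'i * psum (fun i => `|(f - 'i *: g) i| ^+ 2) A +
   ('i * psum (fun i => `|(f + 'i *: g) i| ^+ 2) A +
   (-1 * psum (fun i => `|(f - g) i| ^+ 2) A +
    psum (fun i => `|(f + g) i| ^+ 2) A))) + 0).
  by rewrite tc; rewrite -tc /ell2_inner; rewrite -tc in h; rewrite (usumP h).
apply/funext => A; rewrite /t /psum; under eq_bigr do rewrite polarization.
rewrite -mulr_sumr !big_split/= !sumrN -!mulr_sumr; ring.
Qed.

Lemma ell2_innerDZ (a : C) (f g h : ell2) :
  ell2_inner (a *: f + g) h = a * ell2_inner f h + ell2_inner g h.
Proof.
apply: usumP.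
have -> : psum (fun i => inner ((a *: f + g) i) (h i)) =
    (fun A => a *: psum (fun i => inner (f i) (h i)) A
      + psum (fun i => inner (g i) (h i)) A).
  apply/funext => A; rewrite /psum.
  under eq_bigr do rewrite -[(a *: f + g) _]/(a *: f _ + g _) linearPl/=.
  by rewrite big_split/= -mulr_sumr.
by apply: cvgD; [apply: cvgZl_tmp|]; exact: ell2_inner_cvg.
Qed.

Lemma ell2_innerC (f g : ell2) : ell2_inner f g = (ell2_inner g f)^*.
Proof.
apply: usumP.
have -> : psum (fun i => inner (f i) (g i)) =
    (fun A => (psum (fun i => inner (g i) (f i)) A)^* : C^o).
  apply/funext => A; rewrite /psum rmorph_sum/=.
  by apply: eq_bigr => i _; rewrite hermC/= expr0 mul1r.
have := @ell2_inner_cvg g f; move=> /cvgrPdist_lt h.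
apply/cvgrPdist_lt => e e0; near=> A.
rewrite -rmorphB/= norm_conjC; near: A; exact: h.
Unshelve. all: by end_near. Qed.

Lemma ell2_inner_bilinear : bilinear_for *%R ((@Num.conj C) \; *%R) ell2_inner.
Proof.
split=> [h a f g|h a f g]; first exact: ell2_innerDZ.
by rewrite ell2_innerC ell2_innerDZ rmorphD rmorphM/= -!ell2_innerC.
Qed.
HB.instance Definition _ := bilinear_isBilinear.Build C ell2 ell2 C
  *%R ((@Num.conj C) \; *%R) ell2_inner ell2_inner_bilinear.

Lemma ell2_inner_herm (f g : ell2) :
  ell2_inner f g = (-1) ^+ false * (ell2_inner g f)^*.
Proof. by rewrite expr0 mul1r ell2_innerC. Qed.
HB.instance Definition _ := isHermitianSesquilinear.Build C ell2 false
  (@Num.conj C) ell2_inner ell2_inner_herm.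

Lemma ell2_inner_ge (f : ell2) A : psum (fun i => `|f i| ^+ 2) A <= ell2_inner f f.
Proof.
have [s [sf fs _]] := ell2_cvg f.
have -> : ell2_inner f f = s => //.
by apply: usumP; under [X in psum X]funext do rewrite -normsqE.
Qed.

Lemma ell2_inner_le (f : ell2) (M : C) :
  (forall A, psum (fun i => `|f i| ^+ 2) A <= M) -> ell2_inner f f <= M.
Proof.
have [s [sf _ fs]] := ell2_cvg f; move=> /fs.
have -> : ell2_inner f f = s => //.
by apply: usumP; under [X in psum X]funext do rewrite -normsqE.
Qed.

Lemma ell2_ext (f g : ell2) : f =1 g -> f = g.
Proof. by move=> fg; apply/val_inj/funext. Qed.

Lemma ell2_inner_gt0 (f : ell2) : f != 0 -> 0 < ell2_inner f f.
Proof.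
move=> f0; have [i fi] : exists i, f i != 0.
  apply/not_existsP => fi; move/eqP: f0; apply; apply: ell2_ext => i.
  by have /negP := fi i; rewrite negbK => /eqP.
apply: lt_le_trans (ell2_inner_ge f [fset i]%fset).
by rewrite /psum big_seq_fset1 exprn_gt0// normr_gt0.
Qed.
HB.instance Definition _ := isDotProduct.Build C ell2 ell2_inner ell2_inner_gt0.

HB.instance Definition _ := Lmodule_hasInner.Build R ell2 ell2_inner.

Lemma ell2_norm (f : ell2) : `|f| ^+ 2 = ell2_inner f f.
Proof. by rewrite normE sqrtCK. Qed.

Lemma ell2_norm_ge (f : ell2) i : `|f i| <= `|f|.
Proof.
have := ell2_inner_ge f [fset i]%fset.
by rewrite /psum big_seq_fset1 -ell2_norm ler_sqr ?nnegrE.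
Qed.

Lemma ell2_norm_le (f : ell2) (M : C) : 0 <= M ->
  (forall A : {fset I}, \sum_(i <- A) `|f i| ^+ 2 <= M ^+ 2) -> `|f| <= M.
Proof.
by move=> M0 fM; rewrite -ler_sqr ?nnegrE// ell2_norm; exact: ell2_inner_le.
Qed.

End square_summable.

Section ell2_complete.
Variables (R : realType) (I : choiceType) (E : hilbertType R).
Local Notation C := R[i].

Lemma ell2_complete (F : set_system (ell2 I E)) :
  ProperFilter F -> cauchy F -> cvg F.
Proof.
move=> FF /cauchyP Fc.
have Fe (e : C) : 0 < e -> exists x, F [set y | `|x - y| < e].
  by move=> /Fc[x Fx]; exists x; rewrite -ball_normE in Fx.
have Fi i : cvg ((fun f : ell2 I E => f i) @ F).
  apply/cauchy_cvgP/cauchyP => e /Fe[x Fx]; exists (x i).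
  rewrite -ball_normE; apply: (@filterS _ F _ _ _ _ Fx) => y /=.
  exact/le_lt_trans/(ell2_norm_ge (x - y : ell2 I E)).
pose l i : E := lim ((fun f : ell2 I E => f i) @ F).
have key (x : ell2 I E) (e : C) : 0 < e -> F [set y | `|x - y| < e] ->
    forall A : {fset I}, \sum_(i <- A) `|x i - l i| ^+ 2 <= e ^+ 2.
  move=> e0 Fx A.
  pose G (f : I -> E) : C^o := \sum_(i <- A) `|x i - f i| ^+ 2.
  have Gl : (fun y : ell2 I E => G y) @ F --> (G l : C^o).
    rewrite /G; apply: (@cvg_seqsum R I _ F _ A
      (fun i (y : ell2 I E) => `|x i - y i| ^+ 2)) => i.
    have h : (fun y : ell2 I E => `|x i - y i| : C^o) @ F -->
      (`|x i - l i| : C^o).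
      apply: cvg_norm; apply: cvgB; [exact: cvg_cst|exact: Fi].
    exact: (cvgM h h).
  have G0 (f : I -> E) : 0 <= G f by apply: sumr_ge0 => i _; rewrite exprn_ge0.
  rewrite -[leLHS]/(G l) real_leNgt ?ger0_real// ?exprn_ge0 ?ltW//.
  apply/negP => eG; have d0 : 0 < G l - e ^+ 2 by rewrite subr_gt0.
  move/cvgrPdist_lt: Gl => /(_ _ d0) Gl.
  have [y [/= xy Gy]] := filter_ex (filterI Fx Gl).
  have Gye : G y <= e ^+ 2.
    apply: le_trans (ell2_inner_ge (x - y) A) _.
    by rewrite -ell2_norm ler_sqr ?nnegrE// ltW.
  have GR : G l - G y \is Num.real by rewrite realB// ger0_real.
  have := le_lt_trans (real_ler_norm GR) Gy.
  by rewrite ltrD2l ltrN2 => /lt_le_trans/(_ Gye); rewrite ltxx.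
have [x0 Fx0] := Fe 1 ltr01.
have dP : (fun i => x0 i - l i) \in @square_summable_pred R I E.
  by apply/asboolP; exists (1 ^+ 2); exact: key.
pose L : ell2 I E := x0 - Ell2 dP.
have LE i : L i = l i by rewrite -[LHS]/(x0 i - (x0 i - l i)) subKr.
apply/cvg_ex; exists L; apply/cvgrPdist_lt => e e0.
have e20 : 0 < e / 2%:R by rewrite divr_gt0.
have [x Fx] := Fe _ e20.
apply: filterS (Fx) => y /= xy.
rewrite -(subrK x L) -addrA (le_lt_trans (ler_normD _ _))//.
rewrite (splitr e) ler_ltD// distrC.
apply: ell2_norm_le => [|A]; first exact: ltW.
by under eq_bigr do rewrite -[(x - L) _]/(x _ - L _) LE; exact: key.
Qed.
HB.instance Definition _ := Uniform_isComplete.Build (ell2 I E) ell2_complete.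

End ell2_complete.

(* A copy of the product: on [H * K] itself the library puts the sup norm. *)
Definition dsum (H K : Type) : Type := (H * K)%type.

Section dsum.
Variables (R : realType) (H K : preHilbertType R).
Local Notation C := R[i].

HB.instance Definition _ := GRing.Lmodule.copy (dsum H K) (H * K)%type.

Definition dsum_inner (x y : dsum H K) : C := inner x.1 y.1 + inner x.2 y.2.

Lemma dsum_inner_bilinear : bilinear_for *%R ((@Num.conj C) \; *%R) dsum_inner.
Proof.
split=> [z a x y|z a x y]; rewrite /dsum_inner/= ?linearPl/= ?linearPr/=; ring.
Qed.
HB.instance Definition _ := bilinear_isBilinear.Build C (dsum H K) (dsum H K) C
  *%R ((@Num.conj C) \; *%R) dsum_inner dsum_inner_bilinear.

Lemma dsum_inner_herm (x y : dsum H K) :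
  dsum_inner x y = (-1) ^+ false * (dsum_inner y x)^*.
Proof.
rewrite expr0 mul1r /dsum_inner rmorphD/=.
by congr (_ + _); rewrite hermC/= expr0 mul1r.
Qed.
HB.instance Definition _ := isHermitianSesquilinear.Build C (dsum H K) false
  (@Num.conj C) dsum_inner dsum_inner_herm.

Lemma dsum_inner_gt0 (x : dsum H K) : x != 0 -> 0 < dsum_inner x x.
Proof.
case: x => x y; rewrite /dsum_inner/= -pair_eqE/= negb_and => /orP[x0|y0].
  by rewrite ltr_wpDr ?dnorm_ge0 ?dnorm_gt0.
by rewrite ltr_wpDl ?dnorm_ge0 ?dnorm_gt0.
Qed.
HB.instance Definition _ := isDotProduct.Build C (dsum H K) dsum_inner dsum_inner_gt0.
HB.instance Definition _ := Lmodule_hasInner.Build R (dsum H K) dsum_inner.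

Lemma dsum_norm (x : dsum H K) : `|x| ^+ 2 = `|x.1| ^+ 2 + `|x.2| ^+ 2.
Proof. by rewrite !normE !sqrtCK. Qed.

Lemma dsum_norm1 (x : dsum H K) : `|x.1| <= `|x|.
Proof. by rewrite -ler_sqr ?nnegrE// dsum_norm lerDl exprn_ge0. Qed.

Lemma dsum_norm2 (x : dsum H K) : `|x.2| <= `|x|.
Proof. by rewrite -ler_sqr ?nnegrE// dsum_norm lerDr exprn_ge0. Qed.

Lemma dsum_norm_le (x : dsum H K) : `|x| <= `|x.1| + `|x.2|.
Proof.
rewrite -ler_sqr ?nnegrE ?addr_ge0// dsum_norm sqrrD addrAC lerDl.
by rewrite mulrn_wge0// mulr_ge0.
Qed.
End dsum.

Section dsum_complete.
Variables (R : realType) (H K : hilbertType R).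

Lemma dsum_complete (F : set_system (dsum H K)) :
  ProperFilter F -> cauchy F -> cvg F.
Proof.
move=> FF /cauchyP Fc.
have c1 : cvg ((fun x : dsum H K => x.1) @ F).
  apply/cauchy_cvgP/cauchyP => e /Fc[x Fx]; exists x.1.
  rewrite -ball_normE in Fx; rewrite -ball_normE; apply: (@filterS _ F _ _ _ _ Fx) => y /=.
  exact/le_lt_trans/(dsum_norm1 (x - y : dsum H K)).
have c2 : cvg ((fun x : dsum H K => x.2) @ F).
  apply/cauchy_cvgP/cauchyP => e /Fc[x Fx]; exists x.2.
  rewrite -ball_normE in Fx; rewrite -ball_normE; apply: (@filterS _ F _ _ _ _ Fx) => y /=.
  exact/le_lt_trans/(dsum_norm2 (x - y : dsum H K)).
pose l : dsum H K := (lim ((fun x : dsum H K => x.1) @ F), lim ((fun x : dsum H K => x.2) @ F)).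
apply/cvg_ex; exists l; apply/cvgrPdist_lt => e e0.
have e20 : 0 < e / 2%:R by rewrite divr_gt0.
move/cvgrPdist_lt: c1 => /(_ _ e20) c1.
move/cvgrPdist_lt: c2 => /(_ _ e20) c2.
apply: filterS (filterI c1 c2) => x /= [x1 x2].
by rewrite (le_lt_trans (dsum_norm_le _))// (splitr e) ltrD.
Qed.
HB.instance Definition _ := Uniform_isComplete.Build (dsum H K) dsum_complete.
End dsum_complete.

Section clrange.
Variables (R : realType) (H K : preHilbertType R) (T : bop H K).
Local Notation C := R[i].

Definition clrange_pred : {pred K} := fun y => `[< closure (range T) y >].

Record clrange := Clrange { clrange_val :> K ; _ : clrange_val \in clrange_pred }.
HB.instance Definition _ := [isSub for clrange_val].
HB.instance Definition _ := [Choice of clrange by <:].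

Lemma clrangeP (y : K) : y \in clrange_pred <->
  forall e : C, 0 < e -> exists x, `|y - T x| < e.
Proof.
split=> [/asboolP yT e e0|h].
  have [_ [[x _ <-]]] := yT _ (nbhsx_ballx y e e0).
  by rewrite -ball_normE => xy; exists x.
apply/asboolP => B /nbhs_ballP[e /= e0 eB]; have [x xy] := h _ e0.
by exists (T x); split; [exists x|apply: eB; rewrite -ball_normE].
Qed.

Lemma clrange_submod : submod_closed clrange_pred.
Proof.
split=> [|a x y /clrangeP xT /clrangeP yT]; apply/clrangeP => e e0.
  by exists 0; rewrite linear0 subrr normr0.
have e20 : 0 < e / 2%:R by rewrite divr_gt0.
have a0 : 0 < `|a| + 1 by rewrite ltr_wpDl.
have [x' hx] := xT _ (divr_gt0 e20 a0); have [y' hy] := yT _ e20.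
exists (a *: x' + y'); rewrite linearP opprD addrACA -scalerBr.
rewrite (le_lt_trans (ler_normD _ _))// (splitr e) ler_ltD// normrZ.
rewrite (@le_trans _ _ ((`|a| + 1) * `|x - T x'|))//.
  by rewrite ler_wpM2r// lerDl.
by rewrite mulrC -ler_pdivlMr// ltW.
Qed.
HB.instance Definition _ :=
  GRing.isSubmodClosed.Build _ _ clrange_pred clrange_submod.
HB.instance Definition _ := [SubChoice_isSubLmodule of clrange by <:].

Definition clrange_inner (x y : clrange) : C := inner (val x) (val y).

Lemma clrange_inner_bilinear :
  bilinear_for *%R ((@Num.conj C) \; *%R) clrange_inner.
Proof.
by split=> [z a x y|z a x y]; rewrite /clrange_inner/= ?linearPl/= ?linearPr.
Qed.
HB.instance Definition _ := bilinear_isBilinear.Build C clrange clrange C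
  *%R ((@Num.conj C) \; *%R) clrange_inner clrange_inner_bilinear.

Lemma clrange_inner_herm (x y : clrange) :
  clrange_inner x y = (-1) ^+ false * (clrange_inner y x)^*.
Proof. by rewrite /clrange_inner hermC. Qed.
HB.instance Definition _ := isHermitianSesquilinear.Build C clrange false
  (@Num.conj C) clrange_inner clrange_inner_herm.

Lemma clrange_inner_gt0 (x : clrange) : x != 0 -> 0 < clrange_inner x x.
Proof. by move=> x0; rewrite dnorm_gt0 -(inj_eq val_inj) in x0 *. Qed.
HB.instance Definition _ :=
  isDotProduct.Build C clrange clrange_inner clrange_inner_gt0.
HB.instance Definition _ := Lmodule_hasInner.Build R clrange clrange_inner.

Lemma clrange_norm (x : clrange) : `|x| = `|val x|.
Proof. by rewrite !normE. Qed.

End clrange.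

Section clrange_complete.
Variables (R : realType) (H K : hilbertType R) (T : bop H K).

Lemma clrange_complete (F : set_system (clrange T)) :
  ProperFilter F -> cauchy F -> cvg F.
Proof.
move=> FF /cauchyP Fc.
have c : cvg ((fun x : clrange T => val x) @ F).
  apply/cauchy_cvgP/cauchyP => e /Fc[x Fx]; exists (val x).
  rewrite -ball_normE in Fx; rewrite -ball_normE; apply: (@filterS _ F _ _ _ _ Fx) => y /=.
  by rewrite clrange_norm.
move/cvgrPdist_lt: c; set l := lim _ => c.
have lT : l \in clrange_pred T.
  apply/clrangeP => e e0; have e20 : 0 < e / 2%:R by rewrite divr_gt0.
  have [x /= lx] := filter_ex (c _ e20).
  have /clrangeP/(_ _ e20)[y xy] := valP x.
  exists y; rewrite -(subrK (val x) l) -addrA.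
  by rewrite (le_lt_trans (ler_normD _ _))// (splitr e) ltrD.
apply/cvg_ex; exists (Clrange lT); apply/cvgrPdist_lt => e e0.
by apply: filterS (c _ e0) => x /=; rewrite clrange_norm.
Qed.
HB.instance Definition _ := Uniform_isComplete.Build (clrange T) clrange_complete.
End clrange_complete.

Section ell2_operators.
Variables (R : realType).
Implicit Types E F : preHilbertType R.
Local Notation C := R[i].

Lemma bop_ge0_bound (V W : normedModType C) (T : bop V W) :
  exists2 M : C, 0 <= M & forall x, `|T x| <= M * `|x|.
Proof.
have [_ [M TM]] := bopP T; exists `|M| => // x.
have [->|x0] := eqVneq x 0; first by rewrite linear0 !normr0 mulr0.
rewrite ger0_norm//; have := le_trans (normr_ge0 _) (TM x).
by rewrite pmulr_lge0// normr_gt0.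
Qed.

Section ell2_op.
Variables (I : choiceType) (U : normedModType C) (E : preHilbertType R).
Variables (f : U -> I -> E) (M : C).
Hypotheses (f_lin : forall i, linear (f^~ i)) (M0 : 0 <= M)
  (fM : forall x (A : {fset I}), \sum_(i <- A) `|f x i| ^+ 2 <= (M * `|x|) ^+ 2).

Let f_sq x : f x \in @square_summable_pred R I E.
Proof. by apply/asboolP; exists ((M * `|x|) ^+ 2). Qed.

Let f_bounded : bounded_op (fun x => Ell2 (f_sq x)).
Proof.
split=> [a x y|]; first by apply: ell2_ext => i; exact: f_lin.
by exists M => x; apply: ell2_norm_le; [rewrite mulr_ge0|exact: fM].
Qed.

Definition ell2_op : bop U (ell2 I E) := mkbop f_bounded.
End ell2_op.

Section coordinates.
Variables (I : choiceType) (E : preHilbertType R).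

Definition single_fun (i : I) (x : E) (j : I) : E := if j == i then x else 0.

Let single_lin i j : linear (single_fun i ^~ j).
Proof. by move=> a x y; rewrite /single_fun; case: eqP; rewrite ?scaler0 ?addr0. Qed.

Let single_bound i (x : E) (A : {fset I}) :
  \sum_(j <- A) `|single_fun i x j| ^+ 2 <= (1 * `|x|) ^+ 2.
Proof.
rewrite mul1r; have [iA|iA] := boolP (i \in A).
  rewrite (big_fsetD1 _ iA)/= {1}/single_fun eqxx big1_fset ?addr0// => j.
  by rewrite !inE => /andP[/negPf ji _] _; rewrite /single_fun ji normr0 expr0n.
rewrite big1_fset ?exprn_ge0// => j jA _; rewrite /single_fun.
by have [ji|_] := eqVneq j i; [rewrite -ji jA in iA|rewrite normr0 expr0n].
Qed.

Definition single (i : I) : bop E (ell2 I E) :=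
  ell2_op (single_lin i) ler01 (single_bound i).

Let component_bounded (i : I) : bounded_op (fun f : ell2 I E => f i).
Proof. by split=> [//|]; exists 1 => f; rewrite mul1r ell2_norm_ge. Qed.

Definition component (i : I) : bop (ell2 I E) E := mkbop (component_bounded i).
End coordinates.

Definition opmx m n E F (T : 'I_m -> 'I_n -> bop E F) :
    bop (ell2 'I_n E) (ell2 'I_m F) :=
  \sum_i \sum_j compop (single F i) (compop (T i j) (component E j)).

Section amplify.
Variables (I : choiceType) (E F : preHilbertType R) (T : bop E F).

Let amp_lin i : linear ((fun f : ell2 I E => T \o f)^~ i).
Proof. by move=> a f g /=; rewrite -linearP. Qed.

Let M := projT1 (cid2 (bop_ge0_bound T)).

Let M0 : 0 <= M. Proof. by rewrite /M; case: cid2. Qed.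

Let amp_bound (f : ell2 I E) (A : {fset I}) :
  \sum_(i <- A) `|(T \o f) i| ^+ 2 <= (M * `|f|) ^+ 2.
Proof.
rewrite exprMn (@le_trans _ _ (M ^+ 2 * \sum_(i <- A) `|f i| ^+ 2))//.
  rewrite mulr_sumr; apply: ler_sum => i _ /=; rewrite -exprMn.
  rewrite ler_sqr ?nnegrE ?mulr_ge0//.
  by rewrite /M; case: cid2.
by rewrite ler_wpM2l ?exprn_ge0// ell2_norm; exact: ell2_inner_ge.
Qed.

Definition amplify : bop (ell2 I E) (ell2 I F) := ell2_op amp_lin M0 amp_bound.
End amplify.

Section shift.
Variables (I J : choiceType) (E : preHilbertType R) (s : I -> option J).
Hypothesis s_inj : forall i i' j, s i = Some j -> s i' = Some j -> i = i'.

Definition shift_fun (f : ell2 J E) (i : I) : E := oapp f 0 (s i).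

Let shift_lin i : linear (shift_fun^~ i).
Proof.
by move=> a f g; rewrite /shift_fun; case: (s i) => //=; rewrite scaler0 addr0.
Qed.

Let shift_bound (f : ell2 J E) (A : {fset I}) :
  \sum_(i <- A) `|shift_fun f i| ^+ 2 <= (1 * `|f|) ^+ 2.
Proof.
rewrite mul1r ell2_norm.
have -> : \sum_(i <- A) `|shift_fun f i| ^+ 2 =
    \sum_(j <- pmap s A) `|f j| ^+ 2.
  elim: (enum_fset A) => [|i l IH]; first by rewrite !big_nil.
  rewrite big_cons IH /= /shift_fun; case: (s i) => [j|]/=; first by rewrite big_cons.
  by rewrite normr0 expr0n add0r.
have u : uniq (pmap s A).
  have : uniq A by exact: fset_uniq.
  elim: (enum_fset A) => //= i l IH /andP[il /IH]; case si : (s i) => [j|]//= ->.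
  rewrite andbT mem_pmap; apply/mapP => -[i' i'l /esym].
  by move=> /(s_inj si) ii'; rewrite ii' i'l in il.
have -> : \sum_(j <- pmap s A) `|f j| ^+ 2 =
    psum (fun j => `|f j| ^+ 2) [fset j in pmap s A]%fset.
  rewrite /psum; apply: perm_big; apply: uniq_perm => // j.
  by rewrite inE.
exact: ell2_inner_ge.
Qed.

Definition shift : bop (ell2 J E) (ell2 I E) := ell2_op shift_lin ler01 shift_bound.
End shift.

End ell2_operators.

Section operators.
Variables (R : realType).
Implicit Types H K E F G : hilbertType R.
Local Notation C := R[i].

Definition opnorm H K (T : bop H K) : R :=
  sup [set complex.Re `|T x| | x in [set x | `|x| <= 1]].

Definition is_adjoint H K (T : bop H K) (S : bop K H) : Prop :=
  forall x y, inner (T x) y = inner x (S y).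

(* By Riesz's theorem there is exactly one operator to pick. *)
Definition adj H K (T : bop H K) : bop K H := xget 0 [set S | is_adjoint T S].

Definition op_ge0 H (T : bop H H) : Prop := forall x, 0 <= inner (T x) x.

Definition op_le H (S T : bop H H) : Prop := op_ge0 (T - S).

(* A positive [T] has exactly one positive square root. *)
Definition op_sqrt H (T : bop H H) : bop H H :=
  xget 0 [set S | op_ge0 S /\ compop S S = T].

Definition op_Re H (T : bop H H) : bop H H := 2%:R^-1 *: (T + adj T).

Lemma clrange_subproof H K (T : bop H K) (x : H) : T x \in clrange_pred T.
Proof. by apply/asboolP; apply: subset_closure; exists x. Qed.

Definition to_clrange H K (T : bop H K) (x : H) : clrange T :=
  Clrange (clrange_subproof T x).

Lemma clrange_incl_bounded H K (T : bop H K) : bounded_op (@clrange_val R H K T).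
Proof. by split=> [//|]; exists 1 => x; rewrite mul1r clrange_norm. Qed.

Definition clrange_incl H K (T : bop H K) : bop (clrange T) K :=
  mkbop (clrange_incl_bounded T).

Definition infinite_dim H : Prop :=
  ~ exists s : seq H, forall x, exists c : nat -> C,
    x = \sum_(k < size s) c k *: s`_k.

Section tuples.
Variable n : nat.
Implicit Types (alpha beta gamma : seq 'I_n).

Definition row_norm H (X : 'I_n -> bop H H) : R :=
  Num.sqrt (opnorm (\sum_i compop (X i) (adj (X i)))).

Definition opword H (X : 'I_n -> bop H H) alpha : bop H H :=
  foldr (fun i T => compop (X i) T) (idop H) alpha.

(* [p] stands for [\sum_alpha X_alpha (x) p alpha], and [H (x) C^m] is
   [ell2 'I_m H]. *)
Definition ncpoly m := {fsfun seq 'I_n -> 'M[C]_m with 0}.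

Definition ncpoly_eval m H (p : ncpoly m) (X : 'I_n -> bop H H) :
    bop (ell2 'I_m H) (ell2 'I_m H) :=
  opmx (fun i j => \sum_(alpha <- finsupp p) p alpha i j *: opword X alpha).

(* The positivity of [p] is tested on [K], the domination is on [H]. *)
Definition harnack_le K H (A B : 'I_n -> bop H H) : Prop :=
  exists c : R, 0 < c /\ forall m (p : ncpoly m),
    (forall X : 'I_n -> bop K K, row_norm X < 1 ->
       op_ge0 (op_Re (ncpoly_eval p X))) ->
    op_le (op_Re (ncpoly_eval p A))
          ((c ^+ 2)%:C%C *: op_Re (ncpoly_eval p B)).

(* [F^2(H_n) (x) E]: since the [e_alpha] are an orthonormal basis of the Fock
   space, a vector is [\sum_alpha e_alpha (x) f alpha] with [f] square-summable. *)
Definition fock E := ell2 (seq 'I_n) E.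

Definition e_tensor E alpha : bop E (fock E) := single E alpha.

Definition strip_first (i : 'I_n) alpha : option (seq 'I_n) :=
  if alpha is j :: beta then (if j == i then Some beta else None) else None.

Definition strip_last (i : 'I_n) alpha : option (seq 'I_n) :=
  if alpha is j :: beta then
    (if last j beta == i then Some (belast j beta) else None)
  else None.

Lemma strip_first_inj i alpha alpha' beta :
  strip_first i alpha = Some beta -> strip_first i alpha' = Some beta ->
  alpha = alpha'.
Proof.
case: alpha => //= j a; case: eqP => // -> [->].
by case: alpha' => //= j' a'; case: eqP => // -> [->].
Qed.

Lemma strip_last_inj i alpha alpha' beta :
  strip_last i alpha = Some beta -> strip_last i alpha' = Some beta ->
  alpha = alpha'.
Proof.
case: alpha => //= j a; case: eqP => // ja [ab].
case: alpha' => //= j' a'; case: eqP => // ja' [ab'].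
by rewrite lastI ja ab -ab' -ja' -lastI.
Qed.

(* [S_i (x) I] and [R_i (x) I], mapping [e_beta (x) x] to [e_(g_i beta) (x) x]
   and [e_(beta g_i) (x) x] respectively. *)
Definition lcreate E i : bop (fock E) (fock E) := shift E (@strip_first_inj i).
Definition rcreate E i : bop (fock E) (fock E) := shift E (@strip_last_inj i).

Lemma lcreateE E i alpha (x : E) :
  lcreate E i (e_tensor E alpha x) = e_tensor E (i :: alpha) x.
Proof.
apply: ell2_ext => -[|j beta] //=.
rewrite /shift_fun /single_fun/= eqseq_cons.
by have [//|_] := eqVneq j i.
Qed.

Lemma rcreateE E i alpha (x : E) :
  rcreate E i (e_tensor E alpha x) = e_tensor E (rcons alpha i) x.
Proof.
apply: ell2_ext => -[|j beta]/=; rewrite /shift_fun/=.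
  by rewrite /single_fun; case: alpha.
rewrite /single_fun/= [j :: beta]lastI eqseq_rcons.
by have [_|_] := eqVneq (last j beta) i; rewrite ?andbT ?andbF.
Qed.

Definition multi_analytic E G (M : bop (fock E) (fock G)) : Prop :=
  forall i, compop M (lcreate E i) = compop (lcreate G i) M.

(* [theta] stands for the formal series [\sum_alpha R_alpha (x) theta alpha]. *)
Definition fseries E G := seq 'I_n -> bop E G.

Definition fourier_rep E G (M : bop (fock E) (fock G)) (theta : fseries E G) :=
  forall alpha x y, inner (theta (rev alpha) x) y =
    inner (M (e_tensor E [::] x)) (e_tensor G alpha y).

(* [I (x) T] and [R_i (x) T] as formal series. *)
Definition fconst E G (T : bop E G) : fseries E G :=
  fun gamma => if gamma == [::] then T else 0.
Definition frgen E G i (T : bop E G) : fseries E G :=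
  fun gamma => if gamma == [:: i] then T else 0.

(* The product follows [R_alpha R_beta = R_(alpha beta)]. *)
Definition fmul E F G (b : fseries F G) (a : fseries E F) : fseries E G :=
  fun gamma => \sum_(k < (size gamma).+1)
    compop (b (take k gamma)) (a (drop k gamma)).

Definition fexp E (a : fseries E E) k : fseries E E :=
  iter k (fmul a) (fconst (idop E)).

(* [(1 - a)^-1 = \sum_k a^k] for [a] without constant term; [a^k] then has no
   term of degree [< k], so that each coefficient is a finite sum. *)
Definition fgeom E (a : fseries E E) : fseries E E :=
  fun gamma => \sum_(k < (size gamma).+1) fexp a k gamma.

Section dilation.
Variables (H : hilbertType R) (T : 'I_n -> bop H H).

Definition Delta : bop (ell2 'I_n H) (ell2 'I_n H) :=
  op_sqrt (opmx (fun i j => (i == j)%:R *: idop H - compop (adj (T i)) (T j))).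

Definition defect_space := clrange Delta.

(* [h |-> 1 (x) Delta (0, ..., h, ..., 0)] with [h] in the [i]-th place. *)
Definition Ddefect (i : 'I_n) (h : H) : fock defect_space :=
  e_tensor defect_space [::] (to_clrange Delta (single H i h)).

Definition dilation_space := dsum H (fock defect_space).

Definition dilation (i : 'I_n) (x : dilation_space) : dilation_space :=
  (T i x.1, Ddefect i x.1 + lcreate defect_space i x.2).

End dilation.

Section conditions.
Variables (H : hilbertType R) (A B : 'I_n -> bop H H).
Variables (Omega0 : bop H (defect_space B)).
Variables (Theta0 : bop (defect_space A) (defect_space B)).

Definition sumRA : bop (fock H) (fock H) :=
  \sum_j compop (rcreate H j) (amplify (seq 'I_n) (adj (A j))).

(* The first series is read term by term, as the inner sum need not converge
   before [I (x) Omega0] is applied. *)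
Definition is_Omega (Omega : bop H (fock (defect_space B))) : Prop :=
  forall h,
    series (fun k => amplify (seq 'I_n) Omega0
                       (iter k sumRA (e_tensor H [::] h))) @ \oo --> Omega h /\
    (fun S : {fset seq 'I_n} => \sum_(alpha <- S)
       e_tensor (defect_space B) alpha (Omega0 (adj (opword A alpha) h)))
      @ summability.totally --> Omega h.

Definition Theta_series : fseries (defect_space A) (defect_space B) :=
  fun gamma => fconst Theta0 gamma +
    fmul (fconst Omega0)
      (fmul (fgeom (fun beta => \sum_j frgen j (adj (A j)) beta))
        (fun beta => \sum_i frgen i
           (compop (component H i) (compop (Delta A) (clrange_incl (Delta A)))) beta))
      gamma.

Definition conditions (Omega : bop H (fock (defect_space B)))
    (Theta : bop (fock (defect_space A)) (fock (defect_space B))) : Prop :=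
  [/\ forall h i, Delta B (val (Omega0 h)) i = adj (A i) h - adj (B i) h,
      is_Omega Omega,
      forall x : defect_space A, Delta A (val x) = Delta B (val (Theta0 x))
    & multi_analytic Theta /\ fourier_rep Theta Theta_series].

(* [h : H] is identified with [(h, 0)]. *)
Definition is_LBA (L : bop (dilation_space B) (dilation_space A)) : Prop :=
  (forall h, L (h, 0) = (h, 0)) /\
  forall i x, L (dilation i x) = dilation i (L x).

End conditions.

End tuples.
End operators.

(* Main.v *)
(* A polynomial with positive real part on the ball of [K] also has positive
   real part on every row of isometries with orthogonal ranges: compress the row
   to a finite-dimensional subspace containing the vectors that are tested, move
   that subspace into [K], shrink by [r < 1] and let [r] tend to [1]. Conversely,
   the matrix [V_b^* V_a] of products of words in a minimal isometric dilation
   of a row contraction [T] is the real part of a polynomial evaluated at [T].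
   On that polynomial, the domination of [A] by [B] reads
   [|\sum_a V_a h_a| <= c |\sum_a W_a h_a|], which is the boundedness of the map
   [L] fixing [H] with [L W_i = V_i L]. Given such an [L], the form
   [c^2 <x, y> - <L x, L y>] is an inner product for large [c], the [W_i] are still
   isometries with orthogonal ranges for it, and positivity of a polynomial on
   them is the domination.

   Since [L] fixes [H], [L^* = [1, 0; Omega, Theta]]. The entries of
   [W_i^* L^* = L^* V_i^*] say that [Omega] and [Theta] are determined by their
   components [Omega0] and [Theta0] along the vacuum, that [Theta] is
   multi-analytic, and that the coefficients are those of (i)-(iv). *)

From HB Require Import structures.
Require Import Defs.
From mathcomp Require Import all_boot all_order all_algebra finmap complex.
From mathcomp Require Import ring lra.
From mathcomp Require Import all_classical all_reals topology normedtype sequences.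
From mathcomp.analysis.showcase Require summability.
From mathcomp.real_closed Require polyrcf.

Set Implicit Arguments.
Unset Strict Implicit.
Unset Printing Implicit Defensive.

Import Order.TTheory GRing.Theory Num.Theory.
Import numFieldNormedType.Exports.
Local Open Scope ring_scope.

(** * Adjoints and square roots *)

Section inner.
Variables (R : realType).
Implicit Types (E F : preHilbertType R).
Local Notation C := R[i].

(** [adj] and [op_sqrt] are choices with default [0]: nothing can be said about them before an
    adjoint and a positive root are known to exist. Hence the construction of both from completeness
    of the space. The gap form is a second inner product on the space of the dilation of [B]. To
    avoid comparing its topology with the given one, positivity of polynomials is proved over a bare
    module with a dot product and a row of linear maps contractive for it. All analysis then happens
    in [K], whose infinite dimension leaves room for the finitely many vectors that are moved there.
    A word of length [l] in the shrunken row carries the factor [r ^+ l], so letting [r] tend to 1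
    is continuity of a real polynomial. Words are read from both ends. The [S_i] add letters in
    front, as the dilation does, while the [R_i] of the formal series add them at the back and
    adjoints reverse products; the reversal in the Fourier coefficients makes the two readings
    agree. *)

Lemma ge0_RRe (x : C) : 0 <= x -> x = (complex.Re x)%:C%C.
Proof. by move=> x0; rewrite RRe_real// ger0_real. Qed.

Lemma innerC E (x y : E) : inner x y = (inner y x)^*.
Proof. by rewrite hermC /= expr0 mul1r. Qed.

Lemma innerDl E (x y z : E) : inner (x + y) z = inner x z + inner y z.
Proof. by rewrite linearDl. Qed.
Lemma innerDr E (x y z : E) : inner z (x + y) = inner z x + inner z y.
Proof. by rewrite linearDr. Qed.
Lemma innerBl E (x y z : E) : inner (x - y) z = inner x z - inner y z.
Proof. by rewrite linearBl. Qed.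
Lemma innerBr E (x y z : E) : inner z (x - y) = inner z x - inner z y.
Proof. by rewrite linearBr. Qed.
Lemma inner0l E (z : E) : inner 0 z = 0. Proof. by rewrite linear0l. Qed.
Lemma inner0r E (z : E) : inner z 0 = 0. Proof. by rewrite linear0r. Qed.
Lemma innerZl E a (x z : E) : inner (a *: x) z = a * inner x z.
Proof. by rewrite linearZl_LR. Qed.
Lemma innerZr E a (x z : E) : inner z (a *: x) = a^* * inner z x.
Proof. by rewrite linearZr_LR. Qed.
Lemma inner_suml E I (r : seq I) P (F : I -> E) z :
  inner (\sum_(i <- r | P i) F i) z = \sum_(i <- r | P i) inner (F i) z.
Proof. by rewrite linear_sumlz. Qed.
Lemma inner_sumr E I (r : seq I) P (F : I -> E) z :
  inner z (\sum_(i <- r | P i) F i) = \sum_(i <- r | P i) inner z (F i).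
Proof. by rewrite linear_sumr. Qed.

Lemma innerNl E (x z : E) : inner (- x) z = - inner x z.
Proof. by rewrite linearNl. Qed.

Lemma inner_eq E (x y : E) : (forall z, inner x z = inner y z) -> x = y.
Proof.
move=> xy; apply/eqP; rewrite -subr_eq0 -normr_eq0 -sqrf_eq0.
by rewrite normsqE innerBl xy subrr.
Qed.

Lemma inner_eqr E (x y : E) : (forall z, inner z x = inner z y) -> x = y.
Proof. by move=> xy; apply: inner_eq => z; rewrite innerC xy -innerC. Qed.

End inner.

(** Tested against an arbitrary vector, a vector identity becomes a scalar one within reach of
    [ring]. *)
Ltac vring := apply: inner_eq => ?;
  rewrite !(innerBl, innerDl, innerNl, innerZl, inner0l); ring.

Section hilbert.
Variables (R : realType).
Implicit Types (E F : preHilbertType R).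
Local Notation C := R[i].

Lemma inner_norm_le E (x y : E) : `|inner x y| <= `|x| * `|y|.
Proof.
by rewrite -ler_sqr ?nnegrE ?mulr_ge0// exprMn !normsqE dot_CauchySchwarz.
Qed.

Lemma div_add_mul_le (c e : C) : 0 < c -> 0 < e -> e / (c + e) * c <= e.
Proof.
move=> c0 e0; have ce0 : 0 < c + e by rewrite addr_gt0.
rewrite mulrAC ler_pdivrMr//.
by rewrite mulrDr lerDl mulr_ge0// ltW.
Qed.

Lemma norm_small_eq (V : normedModType C) (x y : V) :
  (forall e : C, 0 < e -> `|x - y| <= e) -> x = y.
Proof.
move=> xy; apply/eqP; rewrite -subr_eq0 -normr_eq0; apply/negP => /negP n0.
have xy0 : 0 < `|x - y| by rewrite lt_def n0 normr_ge0.
have := xy _ (divr_gt0 xy0 (ltr0n _ 2)).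
by rewrite ler_pdivlMr// ger_pMr// (ler_nat C 2 1).
Qed.

(* Completeness without sequences: [P e] plays the role of a shrinking family
   of sets whose diameters tend to 0. *)
Lemma shrinking_limit (H : hilbertType R) (P : C -> H -> Prop) :
  (forall (d e : C) x, 0 < d -> d <= e -> P d x -> P e x) ->
  (forall e : C, 0 < e -> exists x, P e x) ->
  (forall e : C, 0 < e -> exists2 d : C, 0 < d &
     forall x y, P d x -> P d y -> `|x - y| < e) ->
  exists z, forall e : C, 0 < e -> exists x, P e x /\ `|z - x| < e.
Proof.
move=> Pmon Pex Psmall.
pose F : set_system H := [set S | exists2 d : C, 0 < d & (P d `<=` S)%classic]%classic.
have FF : ProperFilter F.
  split; first by move=> [d d0 dS]; have [x /dS] := Pex _ d0.
  split.
  - by exists 1.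
  (* [d * e / (d + e)] is positive and below both radii; it replaces a minimum in the partial order
     of [C]. *)
  - move=> S T [d d0 dS] [e e0 eT]; have de0 : 0 < d * e / (d + e).
      by rewrite divr_gt0 ?mulr_gt0 ?addr_gt0.
    exists (d * e / (d + e)) => // x Px; split; [apply: dS|apply: eT];
      apply: Pmon Px => //; rewrite ler_pdivrMr ?addr_gt0// mulrDr.
      by rewrite lerDr mulr_ge0 ?ltW.
    by rewrite [d * e]mulrC lerDl mulr_ge0 ?ltW.
  - by move=> S T ST [d d0 dS]; exists d => // x /dS /ST.
have /cauchy_cvgP Fc : cauchy F.
  apply/cauchyP => e /Psmall[d d0 dP]; have [x Px] := Pex _ d0.
  exists x; exists d => // y Py; rewrite -ball_normE /=; exact: dP.
exists (lim F) => e e0; have := Fc _ (nbhsx_ballx (lim F) e e0).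
rewrite -ball_normE => Fe.
have Pe : F (P e) by exists e.
by have [x [/= zx Px]] := filter_ex (filterI Fe Pe); exists x.
Qed.

(* The representing vector minimizes [|x|^2 - 2 Re (f x)]. *)
Lemma Riesz (H : hilbertType R) (f : H -> C) (M : C) : scalar f -> 0 <= M ->
  (forall x, `|f x| <= M * `|x|) -> exists z, forall x, f x = inner x z.
Proof.
move=> flin M0 fM.
have fD x y : f (x + y) = f x + f y by rewrite -[x]scale1r flin mul1r scale1r.
have f0 : f 0 = 0 by apply/(addrI (f 0)); rewrite -fD !addr0.
have fZ a x : f (a *: x) = a * f x by rewrite -[a *: x]addr0 flin f0 addr0.
pose J x : C := `|x| ^+ 2 - (f x + (f x)^*).
have JE x : J x = (complex.Re (J x))%:C%C.
  rewrite RRe_real// /J rpredB ?rpredX ?normr_real// CrealE.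
  by rewrite rmorphD/= conjCK addrC.
have JM x : - M ^+ 2 <= J x.
  rewrite /J lerBrDr -lerBrDl opprK.
  apply: (@le_trans _ _ (2%:R * (M * `|x|))).
    have re : f x + (f x)^* \is Num.real by rewrite CrealE rmorphD/= conjCK addrC.
    apply: le_trans (real_ler_norm re) _; apply: le_trans (ler_normD _ _) _.
    by rewrite norm_conjC mulr_natl mulr2n lerD.
  rewrite -subr_ge0.
  have -> : `|x| ^+ 2 + M ^+ 2 - 2%:R * (M * `|x|) = (`|x| - M) ^+ 2 by ring.
  by rewrite real_exprn_even_ge0// rpredB// ger0_real.
pose S := [set complex.Re (J x) | x in setT]%classic.
have infS : has_inf S.
  split; first by exists (complex.Re (J 0)), 0.
  exists (complex.Re (- M ^+ 2)) => _ [x _ <-].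
  rewrite -lecR -JE; have := JM x.
  rewrite {1}(_ : - M ^+ 2 = (complex.Re (- M ^+ 2))%:C%C)//.
  by rewrite RRe_real// rpredN rpredX// ger0_real.
pose m := inf S.
have mJ x : m%:C%C <= J x.
  by rewrite JE lecR; apply: ge_inf; [case: infS|exists x].
have JD t x y : J (x + t *: y) = J x + `|t| ^+ 2 * `|y| ^+ 2
    - (t * (f y - inner y x) + (t * (f y - inner y x))^*).
  rewrite /J fD fZ !normsqE dnormD -[inner (t *: y) (t *: y)]normsqE normrZ exprMn normsqE.
  rewrite innerZr rmorphD !rmorphM /= conjCK rmorphB /= -innerC [inner x y]innerC.
  ring.
have [z zP] : exists z, forall e : C, 0 < e -> exists x, J x < m%:C%C + e /\ `|z - x| < e.
  apply: shrinking_limit => [d e x d0 de Jx|e e0|e e0].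
  - by apply: lt_le_trans Jx _; rewrite lerD2l.
  - have e0' : 0 < complex.Re e by rewrite -ltcR -ge0_RRe ?ltW.
    have [_ [x _ <-] xm] := inf_adherent e0' infS.
    by exists x; rewrite JE (ge0_RRe (ltW e0)) -rmorphD ltcR.
  (* By the parallelogram law two near-minimizers are close, as their midpoint cannot go below [m]:
     an excess of [e ^+ 2 / 4] at each of them bounds the squared distance by [e ^+ 2]. *)
  exists (e ^+ 2 / 4%:R); first by rewrite divr_gt0// exprn_gt0.
  move=> x y Jx Jy; rewrite -[_ < e]ltr_sqr ?nnegrE ?normr_ge0 ?(ltW e0)//.
  have -> : `|x - y| ^+ 2 =
      2%:R * J x + 2%:R * J y - 4%:R * J (2%:R^-1 *: (x + y)).
    rewrite -[LHS](addKr (`|x + y| ^+ 2)) parallelogram /J fZ fD normrZ exprMn.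
    rewrite ger0_norm ?invr_ge0 ?ler0n// rmorphM rmorphD fmorphV rmorph_nat /=.
    by field.
  apply: (@lt_le_trans _ _ (2%:R * (m%:C%C + e ^+ 2 / 4%:R) +
    2%:R * (m%:C%C + e ^+ 2 / 4%:R) - 4%:R * m%:C%C)).
    by rewrite ltr_leB ?ltrD ?ltr_pM2l// ler_pM2l.
  by rewrite le_eqVlt; apply/orP; left; apply/eqP; field.
have Jz : J z <= m%:C%C.
  (* [d * c] collects the errors: [d] from [J x < m + d], and [2 d (M + |z|)] from moving [x] to
     [z], with a surplus [d]. *)
  pose c : C := 2%:R + 2%:R * `|z| + 2%:R * M.
  have c0 : 0 < c by rewrite /c -addrA ltr_wpDr ?addr_ge0 ?mulr_ge0.
  suff Jze (e : C) : 0 < e -> J z <= m%:C%C + e by apply/ler_addgt0Pr.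
  move=> e0; pose d : C := e / (c + e).
  have d0 : 0 < d by rewrite divr_gt0// addr_gt0.
  have dc : d * c <= e by exact: div_add_mul_le.
  have [x [Jx zx]] := zP d d0.
  apply: (@le_trans _ _ (m%:C%C + (d * c))); last by rewrite lerD2l.
  have -> : J z = J x + (J z - J x) by ring.
  apply: (@le_trans _ _ (m%:C%C + d + (J z - J x))); first by rewrite lerD2r ltW.
  rewrite -addrA lerD2l.
  have -> : d * c = d + d * (1 + 2%:R * `|z| + 2%:R * M) by rewrite /c; ring.
  rewrite lerD2l.
  have -> : J z - J x = - `|x - z| ^+ 2 +
      ((f (x - z) - inner (x - z) z) + (f (x - z) - inner (x - z) z)^*).
    have := JD 1 z (x - z); rewrite scale1r addrC subrK => ->.
    by rewrite normr1; ring.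
  rewrite -[leRHS]add0r lerD// ?oppr_le0 ?exprn_ge0//.
  set w := _ - _; have wR : w + w^* \is Num.real by rewrite CrealE rmorphD/= conjCK addrC.
  apply: le_trans (real_ler_norm wR) _; apply: le_trans (ler_normD _ _) _.
  rewrite norm_conjC -mulr2n -(mulr_natl `|w|).
  have wd : `|w| <= d * (M + `|z|).
    apply: le_trans (ler_normB _ _) _; rewrite mulrDr lerD//.
      by rewrite mulrC (le_trans (fM _))// ler_wpM2l// distrC ltW.
    by rewrite (le_trans (inner_norm_le _ _))// ler_wpM2r// distrC ltW.
  rewrite (le_trans (ler_wpM2l _ wd))//.
  by rewrite -subr_ge0 (_ : _ - _ = d); [exact: ltW|ring].
exists z => y; apply/eqP; rewrite -subr_eq0 -normr_eq0 -sqrf_eq0.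
set w := f y - inner y z.
pose s : C := (`|y| ^+ 2 + 1)^-1.
have y1 : 0 < `|y| ^+ 2 + 1 by rewrite ltr_wpDl ?exprn_ge0.
have s0 : 0 < s by rewrite invr_gt0.
have := le_trans Jz (mJ (z + (s * w^*) *: y)).
rewrite JD -/w -addrA lerDl subr_ge0.
have -> : s * w^* * w + (s * w^* * w)^* = (s * `|w| ^+ 2) * 2%:R.
  rewrite normCK !rmorphM /= conjCK (conj_Creal (gtr0_real s0)); ring.
rewrite normrM norm_conjC (gtr0_norm s0) exprMn.
have -> : s ^+ 2 * `|w| ^+ 2 * `|y| ^+ 2 = s * `|w| ^+ 2 * (s * `|y| ^+ 2) by ring.
move=> h; have : s * `|w| ^+ 2 <= 0.
  rewrite -(lerD2r (s * `|w| ^+ 2)) add0r -mulr2n -mulr_natr (le_trans h)//.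
  apply: ler_piMr; first by rewrite mulr_ge0 ?exprn_ge0// ltW.
  by rewrite /s mulrC ler_pdivrMr// mul1r lerDl ler01.
by rewrite pmulr_rle0// => w0; rewrite eq_le w0 exprn_ge0.
Qed.

Lemma bop_ext (V W : normedModType C) (S T : bop V W) : S =1 T -> S = T.
Proof. by move=> ST; apply/val_inj/funext. Qed.

Section approx.
Variables (V : normedModType C) (S : V -> Prop).

Definition approx (x : V) : Prop :=
  forall e : C, 0 < e -> exists2 y, S y & `|x - y| < e.

Lemma approx_in x : S x -> approx x.
Proof. by move=> Sx e e0; exists x; rewrite ?subrr ?normr0. Qed.

Lemma approx_lim x :
  (forall e : C, 0 < e -> exists2 y, approx y & `|x - y| < e) -> approx x.
Proof.
move=> h e e0; have e20 : 0 < e / 2%:R by rewrite divr_gt0.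
have [y ay xy] := h _ e20; have [z Sz yz] := ay _ e20; exists z => //.
rewrite -(subrK y x) -addrA (le_lt_trans (ler_normD _ _))//.
by rewrite (splitr e) ltrD.
Qed.

Hypotheses (S0 : S 0) (SD : forall x y, S x -> S y -> S (x + y)).

Lemma approxD x y : approx x -> approx y -> approx (x + y).
Proof.
move=> ax ay e e0; have e20 : 0 < e / 2%:R by rewrite divr_gt0.
have [[x' Sx xx] [y' Sy yy]] := (ax _ e20, ay _ e20).
exists (x' + y'); first exact: SD.
by rewrite opprD addrACA (le_lt_trans (ler_normD _ _))// (splitr e) ltrD.
Qed.

Lemma approx_sum I (r : seq I) (F : I -> V) :
  (forall i, approx (F i)) -> approx (\sum_(i <- r) F i).
Proof.
move=> aF; elim: r => [|i r IH]; first by rewrite big_nil; exact: approx_in.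
by rewrite big_cons; exact: approxD.
Qed.
End approx.

(** Cauchy-Schwarz bounds the square of the norm of [S y], for [S] an adjoint, by a multiple of that
    norm; this lemma cancels one factor. *)
Lemma norm_le_of_sqr (x a : C) : 0 <= x -> 0 <= a -> x ^+ 2 <= a * x -> x <= a.
Proof.
rewrite le_eqVlt => /orP[/eqP <-//|x0] a0.
by rewrite expr2 ler_pM2r.
Qed.

(** Riesz's theorem, applied to [inner (T x) y] as a functional of [x], gives the value of an
    adjoint at each [y]; uniqueness of representing vectors makes these values linear in [y]. *)
Lemma adjE (H K : hilbertType R) (T : bop H K) x y :
  inner (T x) y = inner x (adj T y).
Proof.
suff : is_adjoint T (adj T) by exact.
apply: (@xgetPex _ 0 [set S | is_adjoint T S]%classic).
have [M M0 TM] := bop_ge0_bound T.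
have Sex y0 : exists z, forall x, inner (T x) y0 = inner x z.
  apply: (@Riesz _ _ (M * `|y0|)); rewrite ?mulr_ge0//.
    by move=> a u v /=; rewrite linearP innerDl innerZl.
  move=> u; rewrite (le_trans (inner_norm_le _ _))// mulrAC.
  by rewrite ler_wpM2r.
pose S y := projT1 (cid (Sex y)).
have SE u v : inner (T u) v = inner u (S v) by rewrite /S; case: cid.
have Sb : bounded_op S.
  split=> [a u v|]; first by apply: inner_eqr => z; rewrite innerDr innerZr -!SE innerDr innerZr.
  exists M => v; apply: norm_le_of_sqr; rewrite ?mulr_ge0// normsqE -SE.
  rewrite -[leLHS]ger0_norm; last by rewrite SE -normsqE exprn_ge0.
  by rewrite (le_trans (inner_norm_le _ _))// mulrAC ler_wpM2r.
by exists (mkbop Sb) => u v; rewrite SE.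
Qed.

Lemma adj_eq (H K : hilbertType R) (T : bop H K) (S : bop K H) :
  (forall x y, inner (T x) y = inner x (S y)) -> adj T = S.
Proof.
by move=> TS; apply: bop_ext => y; apply: inner_eqr => x; rewrite -adjE TS.
Qed.

Lemma adjEr (H K : hilbertType R) (T : bop H K) x y :
  inner (adj T x) y = inner x (T y).
Proof. by rewrite innerC -adjE -innerC. Qed.

Lemma adjK (H K : hilbertType R) (T : bop H K) : adj (adj T) = T.
Proof. by apply: adj_eq => x y; rewrite adjEr. Qed.

Lemma adj_comp (H K G : hilbertType R) (T : bop K G) (S : bop H K) :
  adj (compop T S) = compop (adj S) (adj T).
Proof. by apply: adj_eq => x y /=; rewrite !adjE. Qed.

Lemma adj_idop (H : hilbertType R) : adj (idop H) = idop H.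
Proof. exact: adj_eq. Qed.

Lemma bop_sumE (V W : normedModType C) I (r : seq I) P (F : I -> bop V W) x :
  (\sum_(i <- r | P i) F i) x = \sum_(i <- r | P i) F i x.
Proof. by elim/big_rec2 : _ => // i y1 y2 _ <-. Qed.

(* The square root is [1 - Y], where [Y] is the limit of the iteration
   [Y_(k+1) = (A + Y_k ^ 2) / 2]; it is dominated by the same iteration for the
   scalar [1], which increases to a limit at most [1]. *)
Section sqrt.
Variables (H : hilbertType R) (A : bop H H).
Hypotheses (A_sym : forall x y, inner (A x) y = inner x (A y))
  (A_le1 : forall x, `|A x| <= `|x|).

Fixpoint sqrt_iter k : bop H H :=
  if k is k'.+1 then 2%:R^-1 *: (A + compop (sqrt_iter k') (sqrt_iter k')) else 0.

Fixpoint sqrt_bound k : R :=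
  if k is k'.+1 then 2%:R^-1 * (1 + sqrt_bound k' ^+ 2) else 0.

Lemma sqrt_iterS k x : sqrt_iter k.+1 x = 2%:R^-1 *: (A x + sqrt_iter k (sqrt_iter k x)).
Proof. by []. Qed.

Lemma sqrt_bound_ge0 k : 0 <= sqrt_bound k.
Proof. by elim: k => //= k IH; have := sqr_ge0 (sqrt_bound k); lra. Qed.

Lemma sqrt_bound_le1 k : sqrt_bound k <= 1.
Proof.
elim: k => //= k IH; have := sqrt_bound_ge0 k; nra.
Qed.

Lemma sqrt_bound_mono k l : (k <= l)%N -> sqrt_bound k <= sqrt_bound l.
Proof.
(* The increment is [(1 - b) ^+ 2 / 2] with [b = sqrt_bound j]. *)
have step j : sqrt_bound j <= sqrt_bound j.+1.
  by have := sqr_ge0 (sqrt_bound j - 1); rewrite /=; nra.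
elim: l => [|l IH]; first by rewrite leqn0 => /eqP->.
by rewrite leq_eqVlt => /orP[/eqP->//|/IH/le_trans]; apply.
Qed.

Lemma sqrt_iter_le k x : `|sqrt_iter k x| <= (sqrt_bound k)%:C%C * `|x|.
Proof.
elim: k x => [|k IH] x.
  by rewrite -[sqrt_iter 0 x]/(0 : H) normr0 mul0r.
rewrite sqrt_iterS normrZ /= rmorphM rmorphD rmorphXn fmorphV rmorph_nat /=.
rewrite ger0_norm ?invr_ge0 ?ler0n// -mulrA ler_wpM2l ?invr_ge0 ?ler0n//.
rewrite (le_trans (ler_normD _ _))// mulrDl rmorph1 mul1r lerD//.
by rewrite (le_trans (IH _))// expr2 -mulrA ler_wpM2l ?ler0c ?sqrt_bound_ge0.
Qed.

Lemma sqrt_iter_sub k l x : (k <= l)%N ->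
  `|sqrt_iter l x - sqrt_iter k x| <= (sqrt_bound l - sqrt_bound k)%:C%C * `|x|.
Proof.
have step j y : `|sqrt_iter j.+1 y - sqrt_iter j y| <= (sqrt_bound j.+1 - sqrt_bound j)%:C%C * `|y|.
  elim: j y => [|j IH] y.
    rewrite sqrt_iterS -[sqrt_iter 0 _]/(0 : H) addr0 !subr0 normrZ /= expr0n addr0 mulr1.
    rewrite fmorphV rmorph_nat ger0_norm ?invr_ge0 ?ler0n//.
    by rewrite ler_wpM2l ?invr_ge0 ?ler0n.
  rewrite [sqrt_iter j.+2 y]sqrt_iterS [in X in _ - X]sqrt_iterS.
  set Y := sqrt_iter j.+1; set Z := sqrt_iter j.
  rewrite -scalerBr opprD addrACA subrr add0r normrZ.
  (* This difference of squares holds without commutation, and its two terms match the scalar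
     factorization [b'^2 - b^2 = b' (b' - b) + (b' - b) b]. *)
  have -> : Y (Y y) - Z (Z y) = Y (Y y - Z y) + (Y (Z y) - Z (Z y)).
    by rewrite linearB addrA subrK.
  have -> : (sqrt_bound j.+2 - sqrt_bound j.+1)%:C%C = 2%:R^-1 *
    ((sqrt_bound j.+1)%:C%C * (sqrt_bound j.+1 - sqrt_bound j)%:C%C +
     (sqrt_bound j.+1 - sqrt_bound j)%:C%C * (sqrt_bound j)%:C%C) :> C.
    rewrite [sqrt_bound j.+2]/= [X in _ - X]/=.
    rewrite -!rmorphM -rmorphD -(rmorph_nat (real_complex R)) -fmorphV -rmorphM.
    by congr (_%:C)%C; rewrite /=; field.
  rewrite ger0_norm ?invr_ge0 ?ler0n// -mulrA ler_wpM2l ?invr_ge0 ?ler0n//.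
  rewrite (le_trans (ler_normD _ _))// mulrDl lerD//.
    rewrite (le_trans (sqrt_iter_le _ _))// -mulrA ler_wpM2l ?ler0c ?sqrt_bound_ge0//.
  rewrite (le_trans (IH _))// -mulrA ler_wpM2l ?ler0c ?subr_ge0 ?sqrt_bound_mono//.
  exact: sqrt_iter_le.
elim: l => [|l IH]; first by rewrite leqn0 => /eqP->; rewrite !subrr mul0r normr0.
rewrite leq_eqVlt => /orP[/eqP->|]; first by rewrite !subrr mul0r normr0.
move=> /IH {}IH; rewrite -(subrK (sqrt_iter l x) (sqrt_iter l.+1 x)) -addrA.
rewrite (le_trans (ler_normD _ _))// (le_trans (lerD (step _ _) IH))//.
by rewrite -mulrDl -rmorphD addrA subrK.
Qed.

Lemma sqrt_bound_cauchy (e : R) : 0 < e -> exists N, forall k, (N <= k)%N ->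
  sqrt_bound k - sqrt_bound N < e.
Proof.
move=> e0; pose S := range sqrt_bound.
have supS : has_sup S.
  split; first by exists (sqrt_bound 0), 0%N.
  by exists 1 => _ [k _ <-]; exact: sqrt_bound_le1.
have [_ [N _ <-] NS] := sup_adherent e0 supS; exists N => k Nk.
rewrite ltrBlDr -ltrBlDl (le_lt_trans _ NS)// lerD2r.
by apply: sup_upper_bound => //; exists k.
Qed.

Lemma sqrt_iter_lim x : exists z, forall e : C, 0 < e ->
  exists N, forall k, (N <= k)%N -> `|z - sqrt_iter k x| < e.
Proof.
have cau (e : C) : 0 < e -> exists N, forall k, (N <= k)%N ->
    `|sqrt_iter k x - sqrt_iter N x| < e.
  move=> e0; have x1 : 0 < `|x| + 1 by rewrite ltr_wpDl.
  have d0 : 0 < e / (`|x| + 1) by rewrite divr_gt0.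
  have rd0 : 0 < complex.Re (e / (`|x| + 1)) by rewrite -ltcR -ge0_RRe ?ltW.
  have [N NP] := sqrt_bound_cauchy rd0; exists N => k /[dup] Nk /NP.
  rewrite -ltcR -(ge0_RRe (ltW d0)) ltr_pdivlMr// => h.
  apply: le_lt_trans (sqrt_iter_sub _ Nk) _; apply: le_lt_trans _ h.
  by rewrite ler_wpM2l ?lerDl// ler0c subr_ge0 sqrt_bound_mono.
pose P (e : C) y := exists N, y = sqrt_iter N x /\ forall k, (N <= k)%N ->
    `|sqrt_iter k x - sqrt_iter N x| < e.
have [||e e0|z zP] := @shrinking_limit H P.
- by move=> d e y d0 de [N [-> NP]]; exists N; split=> // k /NP /lt_le_trans; apply.
- by move=> e /cau[N NP]; exists (sqrt_iter N x), N.
- exists (e / 2%:R) => [|_ _ [N [-> NP]] [M [-> MP]]]; first by rewrite divr_gt0.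
  have := NP _ (leq_maxl N M); have := MP _ (leq_maxr N M).
  set w := sqrt_iter (maxn N M) x => h1 h2.
  have -> : sqrt_iter N x - sqrt_iter M x = (w - sqrt_iter M x) - (w - sqrt_iter N x).
    by vring.
  by rewrite (le_lt_trans (ler_normB _ _))// (splitr e) ltrD.
exists z => e e0; have e20 : 0 < e / 2%:R by rewrite divr_gt0.
have [_ [[N [-> NP]] zN]] := zP _ e20; exists N => k /NP kN.
rewrite -(subrK (sqrt_iter N x) z) -addrA (le_lt_trans (ler_normD _ _))//.
by rewrite (splitr e) ltrD// distrC.
Qed.

(** The limit satisfies [2 Y = A + Y^2], which is [(1 - Y)^2 = 1 - A]. It inherits contractivity and
    symmetry from the iterates, and these two make [1 - Y] positive. *)
Lemma sqrt_exists : exists S : bop H H, op_ge0 S /\ compop S S = idop H - A.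
Proof.
pose Y x := projT1 (cid (sqrt_iter_lim x)).
have YP x (e : C) : 0 < e -> exists N, forall k, (N <= k)%N -> `|Y x - sqrt_iter k x| < e.
  by move: e; rewrite /Y; case: cid.
have k1 k x : `|sqrt_iter k x| <= `|x|.
  rewrite (le_trans (sqrt_iter_le _ _))// ler_piMl//.
  by rewrite -(rmorph1 (real_complex R)) lecR sqrt_bound_le1.
have Y1 x : `|Y x| <= `|x|.
  apply/ler_addgt0Pr => e e0; have [N /(_ _ (leqnn N)) NP] := YP x e e0.
  rewrite -(subrK (sqrt_iter N x) (Y x)) (le_trans (ler_normD _ _))// addrC.
  by rewrite lerD// ltW.
have Yb : bounded_op Y.
  split=> [a u v|]; last by exists 1 => x; rewrite mul1r.
  apply: norm_small_eq => e e0.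
  have a1 : 0 < `|a| + 2%:R by rewrite ltr_wpDl.
  have d0 : 0 < e / (`|a| + 2%:R) by rewrite divr_gt0.
  have [N1 P1] := YP u _ d0; have [N2 P2] := YP v _ d0.
  have [N3 P3] := YP (a *: u + v) _ d0.
  pose k := maxn N1 (maxn N2 N3).
  have {}P1 := P1 k (leq_maxl _ _).
  have {}P2 := P2 k (leq_trans (leq_maxl _ _) (leq_maxr _ _)).
  have {}P3 := P3 k (leq_trans (leq_maxr _ _) (leq_maxr _ _)).
  have -> : Y (a *: u + v) - (a *: Y u + Y v) =
    (Y (a *: u + v) - sqrt_iter k (a *: u + v)) -
    a *: (Y u - sqrt_iter k u) - (Y v - sqrt_iter k v).
    have -> : sqrt_iter k (a *: u + v) = a *: sqrt_iter k u + sqrt_iter k v by exact: linearP.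
    vring.
  rewrite (le_trans (ler_normB _ _))// (le_trans (lerD (ler_normB _ _) (lexx _)))// normrZ.
  rewrite (@le_trans _ _ (e / (`|a| + 2%:R) + `|a| * (e / (`|a| + 2%:R)) + e / (`|a| + 2%:R)))//.
    by rewrite !lerD ?ler_wpM2l// ltW.
  by rewrite le_eqVlt; apply/orP; left; apply/eqP; field; rewrite gt_eqF.
have YE x : Y x = 2%:R^-1 *: (A x + Y (Y x)).
  apply: norm_small_eq => e e0.
  have d0 : 0 < e / 2%:R by rewrite divr_gt0.
  have [N1 P1] := YP x _ d0; have [N2 P2] := YP (Y x) _ d0.
  pose k := maxn N1 N2.
  have {}P2 := P2 k (leq_maxr _ _).
  have P1' := P1 k.+1 (leqW (leq_maxl _ _)); have {}P1 := P1 k (leq_maxl _ _).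
  have -> : Y x - 2^-1 *: (A x + Y (Y x)) = (Y x - sqrt_iter k.+1 x) -
     2^-1 *: ((Y (Y x) - sqrt_iter k (Y x)) + sqrt_iter k (Y x - sqrt_iter k x)).
    by rewrite sqrt_iterS linearB; vring.
  rewrite (le_trans (ler_normB _ _))// [leRHS](splitr e) lerD ?(ltW P1')//.
  rewrite normrZ ger0_norm ?invr_ge0 ?ler0n//.
  rewrite mulrC ler_pM2r ?invr_gt0// [leRHS](splitr e).
  by rewrite (le_trans (ler_normD _ _))// lerD ?ltW// (le_lt_trans (k1 _ _)).
have Ysym u v : inner (Y u) v = inner u (Y v).
  have ksym k x y : inner (sqrt_iter k x) y = inner x (sqrt_iter k y).
    elim: k x y => [|k IH] x y; first by rewrite inner0l inner0r.
    by rewrite !sqrt_iterS innerZl innerZr innerDl innerDr A_sym !IH fmorphV rmorph_nat.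
  apply: (@norm_small_eq C^o) => e e0.
  have a1 : 0 < `|u| + `|v| + 1 by rewrite ltr_wpDl// addr_ge0.
  have d0 : 0 < e / (`|u| + `|v| + 1) by rewrite divr_gt0.
  have [N1 P1] := YP u _ d0; have [N2 P2] := YP v _ d0.
  pose k := maxn N1 N2.
  have {}P2 := P2 k (leq_maxr _ _); have {}P1 := P1 k (leq_maxl _ _).
  have -> : inner (Y u) v - inner u (Y v) =
    inner (Y u - sqrt_iter k u) v - inner u (Y v - sqrt_iter k v).
    by rewrite innerBl innerBr ksym opprB addrA subrK.
  rewrite (le_trans (ler_normB _ _))//.
  rewrite (le_trans (lerD (inner_norm_le _ _) (inner_norm_le _ _)))//.
  apply: le_trans (lerD (ler_wpM2r _ (ltW P1)) (ler_wpM2l _ (ltW P2))) _ => //.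
  rewrite [X in _ + X]mulrC -mulrDr mulrAC ler_pdivrMr// ler_wpM2l ?(ltW e0)//.
  by rewrite addrC lerDl.
exists (idop H - mkbop Yb); split.
  move=> x; change (0 <= inner (x - Y x) x); rewrite innerBl -normsqE subr_ge0.
  have Yr : inner (Y x) x \is Num.real by rewrite CrealE -innerC Ysym.
  rewrite (le_trans (real_ler_norm Yr))// (le_trans (inner_norm_le _ _))//.
  by rewrite expr2 ler_wpM2r.
apply: bop_ext => x; rewrite -[LHS]/(x - Y x - Y (x - Y x)) -[RHS]/(x - A x).
rewrite -[Y (x - Y x)]/(mkbop Yb (x - Y x)) linearB /=.
have : A x = Y x + Y x - Y (Y x).
  have YY : Y x + Y x = A x + Y (Y x).
    by rewrite {1 2}YE -scalerDl -[RHS]scale1r; congr (_ *: _); field.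
  by rewrite YY addrK.
by move=> ->; vring.
Qed.
End sqrt.

(** The quadratic form is real at [x + y] and at [x + 'i *: y], which fixes the two parts of the
    off-diagonal terms. The definition of [op_sqrt] asks for positivity only, so the symmetry of
    [Delta] comes from here. *)
Lemma op_ge0_sym (H : hilbertType R) (S : bop H H) x y :
  op_ge0 S -> inner (S x) y = inner x (S y).
Proof.
move=> S0; have Sr z : inner (S z) z = (inner (S z) z)^* by rewrite conj_Creal// ger0_real.
have := Sr (x + y); have := Sr (x + 'i *: y).
have -> : S (x + 'i *: y) = S x + 'i *: S y by rewrite linearD linearZ.
have -> : S (x + y) = S x + S y by exact: linearD.
rewrite !innerDl !innerDr !innerZl !innerZr.
rewrite !rmorphD !rmorphM /= !conjCK !conjCi -!Sr [inner x (S y)]innerC.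
have i0 : 'i != 0 :> C by rewrite neq0Ci.
set a := inner (S x) y; set b := inner (S y) x; set c := inner (S x) x; set d := inner (S y) y.
move=> h1 h2.
have {h1}h1 : b - a = a^* - b^*.
  apply: (mulfI i0); apply: (addrI (c - 'i * ('i * d))).
  have -> : c - 'i * ('i * d) + 'i * (b - a) = c + - 'i * a + ('i * b + 'i * (- 'i * d)) by ring.
  by rewrite h1; ring.
have {h2}h2 : a + b = a^* + b^*.
  apply: (addrI (c + d)); have -> : c + d + (a + b) = c + a + (b + d) by ring.
  by rewrite h2; ring.
have h : 2%:R * b = 2%:R * a^*.
  have -> : 2%:R * b = (b - a) + (a + b) by ring.
  by rewrite h1 h2; ring.
have -> : b = a^* by apply: (mulfI _ h); rewrite pnatr_eq0.
by rewrite conjCK.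
Qed.

End hilbert.

(** * Coordinates and truncations of square-summable families *)

Section ell2.
Variables (R : realType).
Implicit Types (E F : preHilbertType R) (I : choiceType).
Local Notation C := R[i].

Lemma usum_finite I (u : I -> C) (A : {fset I}) :
  (forall i, i \notin A -> u i = 0) -> usum u = \sum_(i <- A) u i.
Proof.
move=> uA; apply: usumP; apply/cvgrPdist_lt => e e0.
exists A => //= B AB; rewrite /psum (big_fsetID _ (mem A) B)/=.
have -> : [fset x in B | x \in A]%fset = A.
  by apply/fsetP => x; rewrite !inE andbC; case: (boolP (x \in A)) => // /(fsubsetP AB).
rewrite [X in _ - (_ + X)]big1_fset; last by move=> i; rewrite !inE => /andP[_ /uA].
by rewrite addr0 subrr normr0.
Qed.

Lemma ell2_innerE E (I : finType) (f g : ell2 I E) :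
  inner f g = \sum_i inner (f i) (g i).
Proof.
rewrite -[LHS]/(ell2_inner f g) /ell2_inner (@usum_finite _ _ [fset i in enum I]%fset).
  rewrite (perm_big (enum I)) ?big_enum//.
  apply: uniq_perm; rewrite ?fset_uniq ?enum_uniq// => i.
  by rewrite !inE.
by move=> i; rewrite !inE mem_enum.
Qed.

Lemma inner_singlel E I i (x : E) (f : ell2 I E) :
  inner (single E i x) f = inner x (f i).
Proof.
rewrite -[LHS]/(ell2_inner (single E i x) f) /ell2_inner (@usum_finite _ _ [fset i]%fset).
  by rewrite big_seq_fset1 /= /single_fun eqxx.
by move=> j; rewrite inE /= /single_fun => /negPf->; rewrite inner0l.
Qed.

Lemma inner_singler E I i (x : E) (f : ell2 I E) :
  inner f (single E i x) = inner (f i) x.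
Proof. by rewrite innerC inner_singlel -innerC. Qed.

Lemma singleE E I (i : I) (x : E) (j : I) : single E i x j = if j == i then x else 0.
Proof. by []. Qed.

Lemma norm_single E I i (x : E) : `|single E (i : I) x| = `|x|.
Proof.
apply/eqP; rewrite -(@eqrXn2 _ 2)// !normsqE inner_singlel singleE eqxx//.
Qed.

Lemma ell2_sumE E I J (r : seq J) P (F : J -> ell2 I E) i :
  (\sum_(j <- r | P j) F j) i = \sum_(j <- r | P j) F j i.
Proof. by elim/big_rec2 : _ => // j y1 y2 _ <-. Qed.

Lemma ell2_decomp E (I : finType) (f : ell2 I E) : f = \sum_i single E i (f i).
Proof.
apply: ell2_ext => i; rewrite ell2_sumE (bigD1 i)//= big1 ?addr0; last first.
  by move=> j ji; rewrite /single_fun eq_sym (negPf ji).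
by rewrite /single_fun eqxx.
Qed.

Lemma opmxE E F m n (T : 'I_m -> 'I_n -> bop E F) f i :
  opmx T f i = \sum_j T i j (f j).
Proof.
rewrite /opmx bop_sumE ell2_sumE (bigD1 i)//= [X in _ + X]big1 ?addr0; last first.
  move=> k ki; rewrite bop_sumE ell2_sumE big1// => j _.
  by rewrite /= /single_fun eq_sym (negPf ki).
by rewrite bop_sumE ell2_sumE; apply: eq_bigr => j _; rewrite /= /single_fun eqxx.
Qed.

(** Letting [g] keep coordinates outside [A] serves truncations to any larger finite set and
    truncations of Fock vectors by word length alike. *)
Lemma ell2_trunc E I (f : ell2 I E) (e : C) : 0 < e -> exists A : {fset I},
  forall g : ell2 I E, (forall i, g i = f i \/ g i = 0) ->
    (forall i, i \in A -> g i = f i) -> `|f - g| < e.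
Proof.
move=> e0; have [s [sf fs smin]] := ell2_cvg f.
have e20 : 0 < (e / 2%:R) ^+ 2 by rewrite exprn_gt0// divr_gt0.
move/cvgrPdist_lt: sf => /(_ _ e20) [A _ AP]; have /= sA := AP A (fsubset_refl A).
exists A => g gf gA; apply: (@le_lt_trans _ _ (e / 2%:R)); last first.
  by rewrite ltr_pdivrMr// ltr_pMr// (ltr_nat C 1 2).
apply: ell2_norm_le => [|B]; first by rewrite divr_ge0// ltW.
apply: le_trans (ltW sA); rewrite ger0_norm ?subr_ge0//.
rewrite lerBrDr (le_trans _ (fs (A `|` B)%fset))//.
rewrite /psum (big_fsetID _ (mem A) (A `|` B)%fset)/= addrC.
have -> : [fset x in (A `|` B)%fset | x \in A]%fset = A.
  by apply/fsetP => x; rewrite !inE; case: (x \in A); case: (x \in B).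
rewrite lerD2r.
have -> : [fset x in (A `|` B)%fset | x \notin A]%fset = (B `\` A)%fset.
  by apply/fsetP => x; rewrite !inE; case: (x \in A); case: (x \in B).
rewrite (big_fsetID _ (mem A) B)/= big_seq big1 ?add0r; last first.
  move=> i; rewrite !inE => /andP[_ /gA gi]; change (`|f i - g i| ^+ 2 = 0).
  by rewrite gi subrr normr0 expr0n.
have -> : [fset x in B | x \notin A]%fset = (B `\` A)%fset.
  by apply/fsetP => x; rewrite !inE andbC.
apply: ler_sum => i _; change (`|f i - g i| ^+ 2 <= `|f i| ^+ 2).
by case: (gf i) => ->; rewrite ?subrr ?subr0// normr0 expr0n exprn_ge0.
Qed.

End ell2.

(** * Row contractions *)

Section row.
Variables (R : realType) (n : nat).
Implicit Types (H : hilbertType R).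
Local Notation C := R[i].

(** With the row as one operator, the matrix under the root in [Delta T] is [1 - T^* T], and the row
    norm is read off [T T^*]. *)
Definition rowop H (T : 'I_n -> bop H H) : bop (ell2 'I_n H) H :=
  \sum_i compop (T i) (component H i).

Lemma rowopE H (T : 'I_n -> bop H H) f : rowop T f = \sum_i T i (f i).
Proof. by rewrite /rowop bop_sumE. Qed.

Lemma adj_rowopE H (T : 'I_n -> bop H H) x i : adj (rowop T) x i = adj (T i) x.
Proof.
apply: inner_eqr => y; rewrite -inner_singlel -!adjE rowopE (bigD1 i)//= big1 ?addr0; last first.
  by move=> j ji; rewrite /single_fun (negPf ji) linear0.
by rewrite /single_fun eqxx.
Qed.

Lemma rowop_adjE H (T : 'I_n -> bop H H) x :
  rowop T (adj (rowop T) x) = (\sum_i compop (T i) (adj (T i))) x.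
Proof.
by rewrite rowopE bop_sumE; apply: eq_bigr => i _; rewrite adj_rowopE.
Qed.

Lemma opnorm_has_sup H (T : bop H H) :
  has_sup [set complex.Re `|T x| | x in [set x | `|x| <= 1]]%classic.
Proof.
split; first by exists (complex.Re `|T 0|), 0 => //=; rewrite normr0.
have [M M0 TM] := bop_ge0_bound T; exists (complex.Re M) => _ [x /= x1 <-].
rewrite -lecR -!ge0_RRe// (le_trans (TM x))//.
by rewrite -[leRHS]mulr1 ler_wpM2l.
Qed.

Lemma opnorm_le1 H (T : bop H H) : opnorm T <= 1 -> forall x, `|T x| <= `|x|.
Proof.
move=> T1 x; have [->|x0] := eqVneq x 0; first by rewrite linear0.
have nx : 0 < `|x| by rewrite normr_gt0.
have h : `|T (`|x|^-1 *: x)| <= 1.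
  rewrite (ge0_RRe (normr_ge0 _)) -(rmorph1 (real_complex R)) lecR.
  apply: le_trans T1; apply: sup_upper_bound; first exact: opnorm_has_sup.
  exists (`|x|^-1 *: x) => //=.
  by rewrite normrZ normfV normr_id mulVf ?gt_eqF.
by move: h; rewrite linearZ normrZ normfV normr_id mulrC ler_pdivrMr// mul1r.
Qed.

Lemma opnorm_le H (T : bop H H) (r : R) : (forall x, `|T x| <= r%:C%C * `|x|) ->
  0 <= r -> opnorm T <= r.
Proof.
move=> Tr r0; apply: ge_sup; first by case: (opnorm_has_sup T).
move=> _ [x /= x1 <-]; rewrite -lecR -ge0_RRe//.
by rewrite (le_trans (Tr x))// -[leRHS]mulr1 ler_wpM2l// ler0c.
Qed.

(** The norm of [T T^*] controls [T^*], since the squared norm of [T^* x] is the inner product of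
    [T T^* x] and [x]; the same estimate for the adjoint of [T^*] then controls [T]. *)
Lemma row_norm_le1 H (T : 'I_n -> bop H H) : row_norm T <= 1 ->
  forall f, `|rowop T f| <= `|f|.
Proof.
move=> T1; have {T1} : opnorm (\sum_i compop (T i) (adj (T i))) <= 1.
  move: T1; rewrite /row_norm; set a := opnorm _ => a1.
  (* [Num.sqrt] sends negative numbers to 0, so the bound on the root says nothing about a negative
     [a], which is below 1 anyway. *)
  have [a0|/ltW/le_trans->//] := leP 0 a.
  by rewrite -(sqr_sqrtr a0) exprn_ile1 ?sqrtr_ge0.
move=> /opnorm_le1 T1.
have adj1 x : `|adj (rowop T) x| <= `|x|.
  rewrite -ler_sqr ?nnegrE// normsqE -adjE rowop_adjE.
  rewrite -[leLHS]ger0_norm; last by rewrite -rowop_adjE adjE -normsqE exprn_ge0.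
  by rewrite (le_trans (inner_norm_le _ _))// expr2 ler_wpM2r.
move=> f; apply: norm_le_of_sqr => //; rewrite normsqE adjE.
rewrite -[leLHS]ger0_norm; last by rewrite -adjE -normsqE exprn_ge0.
by rewrite (le_trans (inner_norm_le _ _))// ler_wpM2l.
Qed.

Lemma row_norm_le H (T : 'I_n -> bop H H) (r : R) : 0 <= r ->
  (forall f, `|rowop T f| <= r%:C%C * `|f|) -> row_norm T <= r.
Proof.
move=> r0 Tr; have r0' : 0 <= r%:C%C :> C by rewrite ler0c.
have adjr x : `|adj (rowop T) x| <= r%:C%C * `|x|.
  apply: norm_le_of_sqr; rewrite ?mulr_ge0// normsqE -adjE.
  rewrite -[leLHS]ger0_norm; last by rewrite adjE -normsqE exprn_ge0.
  by rewrite (le_trans (inner_norm_le _ _))// mulrAC ler_wpM2r.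
rewrite /row_norm -[leRHS]ger0_norm// -sqrtr_sqr ler_wsqrtr//.
apply: opnorm_le; last exact: exprn_ge0.
move=> x; rewrite -rowop_adjE (le_trans (Tr _))// rmorphXn expr2 -mulrA.
by rewrite ler_wpM2l.
Qed.

(** The root exists because [T^* T] is a self-adjoint contraction. *)
Lemma DeltaP H (T : 'I_n -> bop H H) : row_norm T <= 1 ->
  op_ge0 (Delta T) /\
  compop (Delta T) (Delta T) = idop _ - compop (adj (rowop T)) (rowop T).
Proof.
move=> /row_norm_le1 T1.
have defT : opmx (fun i j => (i == j)%:R *: idop H - compop (adj (T i)) (T j)) =
    idop _ - compop (adj (rowop T)) (rowop T).
  apply: bop_ext => f; apply: ell2_ext => i; rewrite opmxE.
  change (\sum_j ((i == j)%:R *: f j - adj (T i) (T j (f j))) = f i - adj (rowop T) (rowop T f) i).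
  rewrite adj_rowopE rowopE linear_sum sumrB; congr (_ - _).
  rewrite (bigD1 i)//= eqxx scale1r big1 ?addr0// => j ji.
  by rewrite eq_sym (negPf ji) scale0r.
rewrite /Delta /op_sqrt defT.
apply: (@xgetPex _ 0 [set S | op_ge0 S /\ compop S S = _]%classic).
apply: sqrt_exists => [x y|x] /=; first by rewrite adjEr adjE.
have := T1; set W := rowop T => W1.
apply: norm_le_of_sqr => //; rewrite normsqE adjEr.
rewrite -[leLHS]ger0_norm; last by rewrite -adjEr -normsqE exprn_ge0.
by apply: le_trans (inner_norm_le _ _) _; apply: ler_pM; rewrite ?normr_ge0 ?W1.
Qed.

Lemma inner_Delta H (T : 'I_n -> bop H H) f g : row_norm T <= 1 ->
  inner (Delta T f) (Delta T g) = inner f g - inner (rowop T f) (rowop T g).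
Proof.
move=> /DeltaP[T0 TT]; rewrite -op_ge0_sym//.
have -> : Delta T (Delta T f) = compop (Delta T) (Delta T) f by [].
by rewrite TT; rewrite -[X in inner X _]/(f - adj (rowop T) (rowop T f)) innerBl adjEr.
Qed.

End row.

(** * Creation operators and words *)

Section fock.
Variables (R : realType) (n : nat).
Local Notation C := R[i].

Lemma adj_lcreateE (E : hilbertType R) i (f : fock n E) alpha :
  adj (lcreate E i) f alpha = f (i :: alpha).
Proof.
apply: inner_eqr => x; rewrite -inner_singlel -adjE.
by rewrite (lcreateE i alpha x) inner_singlel.
Qed.

Lemma adj_lcreate_lcreate (E : hilbertType R) i j (f : fock n E) :
  adj (lcreate E i) (lcreate E j f) = (i == j)%:R *: f.
Proof.
apply: ell2_ext => alpha; rewrite adj_lcreateE /= /shift_fun /=.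
rewrite -[RHS]/((i == j)%:R *: f alpha).
by case: eqP; rewrite ?scale1r ?scale0r.
Qed.

Lemma e_tensor_eq (E : hilbertType R) (a : seq 'I_n) (d : E) : e_tensor E a d a = d.
Proof. by rewrite /= /single_fun eqxx. Qed.

Lemma lcreate_nil (E : hilbertType R) i (f : fock n E) : lcreate E i f [::] = 0.
Proof. by []. Qed.

Lemma fock_decomp (E : hilbertType R) (f : fock n E) :
  f = e_tensor E [::] (f [::]) + \sum_i lcreate E i (adj (lcreate E i) f).
Proof.
apply: ell2_ext => -[|j alpha].
  change (f [::] = f [::] + (\sum_i lcreate E i (adj (lcreate E i) f)) [::]).
  by rewrite ell2_sumE big1 ?addr0.
change (f (j :: alpha) = 0 + (\sum_i lcreate E i (adj (lcreate E i) f)) (j :: alpha)).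
rewrite add0r ell2_sumE (bigD1 j)//= big1 ?addr0; last first.
  by move=> i ij; rewrite /shift_fun /= eq_sym (negPf ij).
by rewrite /shift_fun /= eqxx /= adj_lcreateE.
Qed.

Lemma sum_e_tensorE (E : hilbertType R) (u : seq 'I_n -> E) (S : {fset seq 'I_n}) b :
  (\sum_(a <- S) e_tensor E a (u a)) b = if b \in S then u b else 0.
Proof.
rewrite ell2_sumE; case: ifP => [bS|/negbT bS].
  rewrite (big_fsetD1 b)//= /single_fun eqxx big1_fset ?addr0// => a.
  by rewrite !inE eq_sym => /andP[/negPf-> _].
rewrite big1_fset// => a aS _; rewrite /= /single_fun.
by case: eqP => // ab; rewrite ab aS in bS.
Qed.

Lemma opword_cat (H : hilbertType R) (X : 'I_n -> bop H H) a b x :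
  opword X (a ++ b) x = opword X a (opword X b x).
Proof. by elim: a => //= i a ->. Qed.

Lemma adj_opword_cons (H : hilbertType R) (X : 'I_n -> bop H H) i a x :
  adj (opword X (i :: a)) x = adj (opword X a) (adj (X i) x).
Proof. by rewrite /= adj_comp. Qed.

Lemma adj_opword_rcons (H : hilbertType R) (X : 'I_n -> bop H H) a i x :
  adj (opword X (rcons a i)) x = adj (X i) (adj (opword X a) x).
Proof.
elim: a x => [|j a IH] x; first by rewrite /= adj_comp adj_idop.
by rewrite rcons_cons !adj_opword_cons IH.
Qed.

End fock.

(** * Minimal isometric dilations *)

Section dsum_operators.
Variables (R : realType) (U V : preHilbertType R).
Local Notation C := R[i].

Lemma dsum_innerE (x y : dsum U V) :
  inner x y = inner x.1 y.1 + inner x.2 y.2.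
Proof. by []. Qed.

Lemma dinl_bounded : bounded_op (fun h : U => (h, 0) : dsum U V).
Proof.
split=> [a x y|].
  change ((a *: x + y, 0) = (a *: x + y, a *: 0 + 0) :> dsum U V).
  by rewrite scaler0 addr0.
exists 1 => x; rewrite mul1r (le_trans (dsum_norm_le _))//=.
by rewrite normr0 addr0.
Qed.
Definition dinl : bop U (dsum U V) := mkbop (dinl_bounded).

Lemma dinr_bounded : bounded_op (fun h : V => (0, h) : dsum U V).
Proof.
split=> [a x y|].
  change ((0, a *: x + y) = (a *: 0 + 0, a *: x + y) :> dsum U V).
  by rewrite scaler0 addr0.
exists 1 => x; rewrite mul1r (le_trans (dsum_norm_le _))//=.
by rewrite normr0 add0r.
Qed.
Definition dinr : bop V (dsum U V) := mkbop (dinr_bounded).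

Lemma norm_dinr v : `|dinr v| = `|v|.
Proof.
by apply/eqP; rewrite -(@eqrXn2 _ 2)// !normsqE dsum_innerE /= inner0l add0r.
Qed.

Lemma dsnd_bounded : bounded_op (fun x : dsum U V => x.2).
Proof. by split=> [//|]; exists 1 => x; rewrite mul1r dsum_norm2. Qed.
Definition dsnd : bop (dsum U V) V := mkbop dsnd_bounded.

Lemma dfst_bounded : bounded_op (fun x : dsum U V => x.1).
Proof. by split=> [//|]; exists 1 => x; rewrite mul1r dsum_norm1. Qed.
Definition dfst : bop (dsum U V) U := mkbop dfst_bounded.

Lemma dsum_decomp (x : dsum U V) : x = dinl x.1 + dinr x.2.
Proof.
case: x => u v; change ((u, v) = (u + 0, 0 + v) :> dsum U V).
by rewrite addr0 add0r.
Qed.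

End dsum_operators.
Arguments dinl {R} U V.
Arguments dinr {R} U V.
Arguments dfst {R} U V.
Arguments dsnd {R} U V.

Section words.
Variables (R : realType) (n : nat) (H : hilbertType R).
Local Notation C := R[i].

(* The value of [inner (V_a h) (V_b k)] for a minimal isometric dilation [V] of [T]. *)
Fixpoint toeplitz (T : 'I_n -> bop H H) (a b : seq 'I_n) (h k : H) : C :=
  match a, b with
  | i :: a', j :: b' => if i == j then toeplitz T a' b' h k else 0
  | [::], _ => inner h (opword T b k)
  | _, [::] => inner (opword T a h) k
  end.

Variables (K : hilbertType R) (V : 'I_n -> bop K K) (j : bop H K).

Definition word_comb (s : seq (seq 'I_n * H)) : K :=
  \sum_(t <- s) opword V t.1 (j t.2).

Lemma word_comb_cat s t : word_comb (s ++ t) = word_comb s + word_comb t.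
Proof. exact: big_cat. Qed.

Lemma word_comb1 a h : word_comb [:: (a, h)] = opword V a (j h).
Proof. exact: big_seq1. Qed.

Lemma word_comb_scale a s : a *: word_comb s = word_comb [seq (t.1, a *: t.2) | t <- s].
Proof.
rewrite /word_comb big_map scaler_sumr; apply: eq_bigr => t _.
by rewrite -!linearZ.
Qed.

Lemma word_comb_step i s : V i (word_comb s) = word_comb [seq (i :: t.1, t.2) | t <- s].
Proof. by rewrite /word_comb big_map linear_sum. Qed.

Definition word_span (x : K) : Prop := exists s, x = word_comb s.

Lemma word_spanD x y : word_span x -> word_span y -> word_span (x + y).
Proof. by move=> [s ->] [t ->]; exists (s ++ t); rewrite word_comb_cat. Qed.

Lemma word_span0 : word_span 0.
Proof. by exists [::]; rewrite /word_comb big_nil. Qed.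

Lemma word_span_word a h : word_span (opword V a (j h)).
Proof. by exists [:: (a, h)]; rewrite word_comb1. Qed.

End words.

Section dilation.
Variables (R : realType) (n : nat) (H : hilbertType R) (T : 'I_n -> bop H H).
Hypothesis T_contr : row_norm T <= 1.
Local Notation C := R[i].
Local Notation D := (defect_space T).
Local Notation K := (dilation_space T).

(** The vacuum parts contribute the entry [delta_ij - T_i^* T_j] of [Delta^2], exactly what the
    components in [H] lack; the created parts have no vacuum component, so there are no cross
    terms. *)
Lemma inner_dilation i j (x y : K) :
  inner (dilation i x) (dilation j y) = (i == j)%:R * inner x y.
Proof.
change (inner (T i x.1) (T j y.1) +
  inner (Ddefect T i x.1 + lcreate D i x.2) (Ddefect T j y.1 + lcreate D j y.2) =
  (i == j)%:R * (inner x.1 y.1 + inner x.2 y.2)).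
rewrite /Ddefect !innerDl !innerDr.
rewrite inner_singlel inner_singlel inner_singler !lcreate_nil inner0l inner0r addr0 add0r.
rewrite [e_tensor _ _ _ _]e_tensor_eq.
rewrite [inner (lcreate _ _ _) _]adjE adj_lcreate_lcreate innerZr rmorph_nat.
rewrite -[inner (to_clrange _ _) _]/(inner (Delta T (single H i x.1)) (Delta T (single H j y.1))).
rewrite inner_Delta// !rowopE inner_singlel singleE.
rewrite (bigD1 i)//= big1 ?addr0; last by move=> k ki; rewrite /single_fun (negPf ki) linear0.
rewrite (bigD1 j)//= big1 ?addr0; last by move=> k ki; rewrite /single_fun (negPf ki) linear0.
rewrite /single_fun !eqxx.
by case: eqP => _; rewrite ?inner0r ?mul1r ?mul0r; ring.
Qed.

Lemma norm_dilation i (x : K) : `|dilation i x| = `|x|.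
Proof.
apply/eqP; rewrite -(@eqrXn2 _ 2)// !normsqE.
by rewrite [inner (dilation _ _) _]inner_dilation eqxx mul1r.
Qed.

Lemma dilation_bounded i : bounded_op (fun x : K => dilation i x : K).
Proof.
split=> [a x y|]; last by exists 1 => x; rewrite mul1r norm_dilation.
congr pair; first by rewrite /= linearP.
change (Ddefect T i (a *: x.1 + y.1) + lcreate D i (a *: x.2 + y.2) =
  a *: (Ddefect T i x.1 + lcreate D i x.2) + (Ddefect T i y.1 + lcreate D i y.2)).
rewrite linearP scalerDr addrACA; congr (_ + _).
rewrite /Ddefect -[RHS]linearP; congr (e_tensor _ _ _); apply: val_inj.
change (Delta T (single H i (a *: x.1 + y.1)) =
  a *: Delta T (single H i x.1) + Delta T (single H i y.1)).
by rewrite !linearP.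
Qed.

Definition dilop i : bop K K := mkbop (dilation_bounded i).

Lemma dilop_word1 a (x : K) : (opword dilop a x).1 = opword T a x.1.
Proof. by elim: a => //= i a ->. Qed.

Lemma dilop_word0 a b d :
  opword dilop a (dinr H (fock n D) (e_tensor D b d)) = dinr H (fock n D) (e_tensor D (a ++ b) d).
Proof.
elim: a => // i a IH.
rewrite -[LHS]/(dilop i (opword dilop a (dinr H (fock n D) (e_tensor D b d)))) IH.
change ((T i 0, Ddefect T i 0 + lcreate D i (e_tensor D (a ++ b) d)) =
  (0, e_tensor D (i :: a ++ b) d) :> K).
rewrite lcreateE linear0 /Ddefect.
have -> : to_clrange (Delta T) (single H i 0) = 0.
  by apply: val_inj; change (Delta T (single H i 0) = 0); rewrite !linear0.
by rewrite linear0 add0r.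
Qed.

Lemma inner_dilop_words a b h k :
  inner (opword dilop a (dinl H (fock n D) h)) (opword dilop b (dinl H (fock n D) k)) =
  toeplitz T a b h k.
Proof.
elim: a b => [|i a IH] b.
  by rewrite dsum_innerE /= dilop_word1 inner0l addr0.
case: b => [|j b]; first by rewrite [LHS]dsum_innerE dilop_word1 /= inner0r addr0.
rewrite -[LHS]/(inner (dilation i (opword dilop a (dinl H (fock n D) h)))
  (dilation j (opword dilop b (dinl H (fock n D) k)))) inner_dilation IH /=.
by case: eqP; rewrite ?mul1r ?mul0r.
Qed.

Lemma inner_dilop_word a h k :
  inner (opword dilop a (dinl H (fock n D) h)) (dinl H (fock n D) k) = inner (opword T a h) k.
Proof. by rewrite dsum_innerE dilop_word1 /= inner0r addr0. Qed.

Local Notation word_span := (word_span dilop (dinl H (fock n D))).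

(** This is minimality. Since [V_i h - T_i h] is the vacuum tensored with
    [Delta (0, ..., h, ..., 0)], applying [V_a] puts such a vector at [e_a]. Sums over [i] reach the
    range of [Delta], limits the defect space, and truncation all Fock vectors. *)
Lemma word_span_dense (x : K) : approx word_span x.
Proof.
have sp_single a i h :
    word_span (dinr H (fock n D) (e_tensor D a (to_clrange (Delta T) (single H i h)))).
  have -> : dinr H (fock n D) (e_tensor D a (to_clrange (Delta T) (single H i h))) =
      opword dilop (rcons a i) (dinl H (fock n D) h) + opword dilop a (dinl H (fock n D) (- T i h)).
    rewrite -cats1 opword_cat -linearD -[X in e_tensor _ X]cats0 -dilop_word0; congr (opword _ _ _).
    change ((0, Ddefect T i h) = (T i h - T i h, Ddefect T i h + lcreate D i 0 + 0) :> K).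
    by rewrite subrr linear0 !addr0.
  by apply: word_spanD; exact: word_span_word.
have ap_Delta a f : approx word_span (dinr H (fock n D) (e_tensor D a (to_clrange (Delta T) f))).
  have -> : to_clrange (Delta T) f = \sum_i to_clrange (Delta T) (single H i (f i)).
    by apply: val_inj; rewrite raddf_sum /= -linear_sum -ell2_decomp.
  rewrite !linear_sum; apply: (approx_sum (word_span0 _ _) (@word_spanD _ _ _ _ _ _)) => i.
  exact/approx_in/sp_single.
have ap_defect a d : approx word_span (dinr H (fock n D) (e_tensor D a d)).
  apply: approx_lim => e e0; have /clrangeP/(_ _ e0)[f df] := valP d.
  exists (dinr H (fock n D) (e_tensor D a (to_clrange (Delta T) f))); first exact: ap_Delta.
  by rewrite -!linearB norm_dinr norm_single clrange_norm.
rewrite (dsum_decomp x); case: x => h xi.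
apply: (approxD (@word_spanD _ _ _ _ _ _)); first exact/approx_in/(word_span_word _ _ [::]).
apply: approx_lim => e e0; have [A Axi] := ell2_trunc xi e0.
exists (dinr H (fock n D) (\sum_(a <- A) e_tensor D a (xi a))).
  rewrite linear_sum; apply: (approx_sum (word_span0 _ _) (@word_spanD _ _ _ _ _ _)) => a.
  exact: ap_defect.
rewrite -linearB norm_dinr; apply: Axi => a; rewrite sum_e_tensorE.
  by case: ifP => _; [left|right].
by move=> ->.
Qed.

End dilation.

(** * Positive noncommutative polynomials *)

Section polynomials.
Variables (R : realType) (n : nat).
Local Notation C := R[i].

Lemma inner_op_Re (H : hilbertType R) (T : bop H H) x :
  inner (op_Re T x) x = 'Re (inner (T x) x).
Proof.
change (inner (2%:R^-1 *: (T x + adj T x)) x = 'Re (inner (T x) x)).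
by rewrite innerZl innerDl adjEr [inner x (T x)]innerC ReE mulrC.
Qed.

Lemma op_le_Re (H : hilbertType R) (S T : bop H H) (c : C) : c \is Num.real ->
  (op_le (op_Re S) (c *: op_Re T) <->
   forall x, 'Re (inner (S x) x) <= c * 'Re (inner (T x) x)).
Proof.
move=> cR; have E x : inner ((c *: op_Re T - op_Re S) x) x =
    c * 'Re (inner (T x) x) - 'Re (inner (S x) x).
  change (inner (c *: op_Re T x - op_Re S x) x = c * 'Re (inner (T x) x) - 'Re (inner (S x) x)).
  by rewrite innerBl innerZl !inner_op_Re.
by split=> h x; have := h x; rewrite ?E subr_ge0.
Qed.

Lemma inner_ncpoly_eval (H : hilbertType R) m (p : ncpoly R n m) (X : 'I_n -> bop H H) x y :
  inner (ncpoly_eval p X x) y = \sum_i \sum_j \sum_(a <- finsupp p)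
    p a i j * inner (opword X a (x j)) (y i).
Proof.
rewrite ell2_innerE; apply: eq_bigr => i _.
rewrite opmxE inner_suml; apply: eq_bigr => j _.
rewrite bop_sumE inner_suml; apply: eq_bigr => a _.
by rewrite -innerZl.
Qed.

Section kernel.
Variables (m : nat) (w : 'I_m -> seq 'I_n).

(* The polynomial whose real part is the matrix of the products [V_b^* V_a],
   for isometries [V] with orthogonal ranges. *)
Definition kernel_coef (a : seq 'I_n) : 'M[C]_m := \matrix_(i, j)
  if prefix (w i) (w j) && (a == drop (size (w i)) (w j))
  then (if w i == w j then 1 else 2%:R) else 0.

(** The listed words may include some coming from pairs where [w i] is not a prefix of [w j]; a
    finite set containing all words with a nonzero coefficient is enough. *)
Definition kernel_poly : ncpoly R n m := [fsfun a in
  [fset drop (size (w ij.1)) (w ij.2) | ij in (predT : {pred 'I_m * 'I_m})]%fset =>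
  kernel_coef a | 0].

Lemma kernel_polyE a : kernel_poly a = kernel_coef a.
Proof.
rewrite /kernel_poly fsfun_fun; case: ifP => // /negbT aS.
apply/matrixP => i j; rewrite !mxE; case: ifP => // /andP[_ /eqP aE].
by move: aS; rewrite aE; move/negP; case; apply/imfsetP; exists (i, j).
Qed.

Variables (H : hilbertType R) (T : 'I_n -> bop H H).

(** The analytic half of the Toeplitz kernel. Off the diagonal only one of the two orders of [a] and
    [b] contributes, hence the factor 2 against the 1/2 of the real part; on the diagonal both
    contribute. *)
Definition half_toeplitz (a b : seq 'I_n) (h k : H) : C :=
  if prefix b a then (if b == a then 1 else 2%:R) * inner (opword T (drop (size b) a) h) k
  else 0.

Lemma toeplitz_half a b h k : toeplitz T a b h k =
  2%:R^-1 * (half_toeplitz a b h k + (half_toeplitz b a k h)^*).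
Proof.
have two : 2%:R^-1 * 2%:R = 1 :> C by rewrite mulVf ?pnatr_eq0.
elim: a b => [|i a IH] [|j b]; rewrite /half_toeplitz.
- rewrite /= !mul1r -innerC -mulr2n -(mulr_natl (inner h k)) mulrA two mul1r //.
- by rewrite /= add0r rmorphM rmorph_nat /= -innerC mulrA two mul1r.
- by rewrite /= rmorph0 addr0 mulrA two mul1r.
rewrite /= !eqseq_cons IH /half_toeplitz [j == i]eq_sym.
by case: eqP => //= _; rewrite rmorph0 addr0 mulr0.
Qed.

Lemma inner_kernel_poly (x : ell2 'I_m H) :
  inner (ncpoly_eval kernel_poly T x) x =
  \sum_i \sum_j half_toeplitz (w j) (w i) (x j) (x i).
Proof.
rewrite inner_ncpoly_eval; apply: eq_bigr => i _; apply: eq_bigr => j _.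
under eq_bigr do rewrite kernel_polyE mxE.
rewrite /half_toeplitz; have [pij|_] := boolP (prefix (w i) (w j)); last first.
  by rewrite big1// => a _; rewrite mul0r.
rewrite /=.
set d := drop _ _; have [dS|dS] := boolP (d \in finsupp kernel_poly).
  rewrite (big_fsetD1 d)//= eqxx big1_fset ?addr0// => a.
  by rewrite !inE => /andP[/negPf-> _] _; rewrite mul0r.
(* Off the support the coefficient at [(i, j)] equals 0, so both sides vanish. *)
have := fsfun_dflt dS; rewrite kernel_polyE => /matrixP/(_ i j).
rewrite !mxE pij eqxx /= => ->; rewrite mul0r big1_fset// => a aS _.
by case: eqP => [ad|_]; [rewrite -ad aS in dS|rewrite mul0r].
Qed.

(** Used three times: with the dilations of [A] and [B] it gives the norms to be compared, and with
    the dilation of a row in the ball it shows the polynomial to be admissible. *)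
Lemma Re_kernel_poly (K : hilbertType R) (V : 'I_n -> bop K K) (j : bop H K)
    (x : ell2 'I_m H) :
  (forall a b h k, inner (opword V a (j h)) (opword V b (j k)) = toeplitz T a b h k) ->
  'Re (inner (ncpoly_eval kernel_poly T x) x) =
  `|\sum_i opword V (w i) (j (x i))| ^+ 2.
Proof.
move=> VT; rewrite normsqE inner_suml ReE inner_kernel_poly rmorph_sum /=.
transitivity (\sum_i \sum_j 2%:R^-1 * (half_toeplitz (w i) (w j) (x i) (x j) +
    (half_toeplitz (w j) (w i) (x j) (x i))^*)).
  under [RHS]eq_bigr do rewrite -mulr_sumr big_split /=.
  rewrite -mulr_sumr mulrC big_split /=; congr (_ * (_ + _)); first exact: exchange_big.
  by apply: eq_bigr => i _; rewrite rmorph_sum.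
apply: eq_bigr => i _; rewrite inner_sumr; apply: eq_bigr => l _.
by rewrite VT toeplitz_half.
Qed.

End kernel.

Lemma harnack_word_comb (K H KA KB : hilbertType R) (A B : 'I_n -> bop H H)
    (V : 'I_n -> bop KA KA) (W : 'I_n -> bop KB KB) (jA : bop H KA) (jB : bop H KB) :
  (forall a b h k, inner (opword V a (jA h)) (opword V b (jA k)) = toeplitz A a b h k) ->
  (forall a b h k, inner (opword W a (jB h)) (opword W b (jB k)) = toeplitz B a b h k) ->
  harnack_le K A B -> exists2 c : C, 0 < c &
    forall s, `|word_comb V jA s| <= c * `|word_comb W jB s|.
Proof.
move=> VA WB [c [c0 AB]]; have c0' : 0 < c%:C%C :> C by rewrite ltcR.
(* Indexing by positions in [s] lets a word occur several times. *)
exists c%:C%C => // s; pose m := size s; pose t (i : 'I_m) := tnth (in_tuple s) i.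
pose x : ell2 'I_m H := \sum_i single H i (t i).2.
have xE i : x i = (t i).2.
  rewrite ell2_sumE (bigD1 i)//= /single_fun eqxx big1 ?addr0// => j ji.
  by rewrite eq_sym (negPf ji).
have combE (K' : hilbertType R) (U : 'I_n -> bop K' K') (j : bop H K') :
    word_comb U j s = \sum_i opword U (t i).1 (j (x i)).
  by rewrite /word_comb big_tnth; apply: eq_bigr => i _; rewrite xE.
rewrite -[X in is_true X]ler_sqr ?nnegrE ?mulr_ge0 ?normr_ge0 ?(ltW c0')// exprMn !combE.
rewrite -(Re_kernel_poly (fun i => (t i).1) x VA) -(Re_kernel_poly (fun i => (t i).1) x WB).
pose p := kernel_poly (fun i => (t i).1).
have [|+ _] := @op_le_Re _ (ncpoly_eval p A) (ncpoly_eval p B) (c ^+ 2)%:C%C.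
  by rewrite ger0_real// ler0c exprn_ge0// ltW.
(* A row in the ball of [K] has an isometric dilation of its own, in which the real part is a
   squared norm. *)
rewrite -rmorphXn; apply; apply: AB => X /ltW X1 y.
by rewrite inner_op_Re (Re_kernel_poly _ _ (inner_dilop_words X1)) exprn_ge0.
Qed.

End polynomials.

(** * Orthonormal families and finite-dimensional compressions *)

Section orthonormal.
Variables (R : realType) (V : lmodType R[i]) (f : {dot V for (@Num.conj R[i])}).
Variables (T : eqType) (p : T -> V).
Local Notation C := R[i].

(** The map [p] allows one list of pairs to be orthonormal in two spaces at once, through its two
    projections. *)
Fixpoint orthonormal_fam (s : seq T) : Prop :=
  if s is t :: s' then [/\ f (p t) (p t) = 1, forall u, u \in s' -> f (p u) (p t) = 0
    & orthonormal_fam s'] else True.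

Definition ocomb (s : seq T) (a : T -> C) : V := \sum_(t <- s) a t *: p t.

Lemma dotC u v : f u v = (f v u)^*.
Proof. by rewrite hermC /= expr0 mul1r. Qed.

Lemma dot_ocombl s a v : f (ocomb s a) v = \sum_(t <- s) a t * f (p t) v.
Proof. by rewrite linear_sumlz; apply: eq_bigr => t _; rewrite linearZl_LR. Qed.

Lemma ocomb_coef s a t : orthonormal_fam s -> t \in s -> f (ocomb s a) (p t) = a t.
Proof.
rewrite dot_ocombl; elim: s => // u s IH [u1 us os]; rewrite inE big_cons.
have [->|tu /= ts] := eqVneq t u.
  by rewrite u1 mulr1 big_seq big1 ?addr0// => v vs; rewrite us// mulr0.
by rewrite (IH os ts) dotC us// rmorph0 mulr0 add0r.
Qed.

Lemma dot_ocomb s a b : orthonormal_fam s ->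
  f (ocomb s a) (ocomb s b) = \sum_(t <- s) a t * (b t)^*.
Proof.
move=> os; rewrite dot_ocombl big_seq [RHS]big_seq; apply: eq_bigr => t ts.
by rewrite [f (p t) _]dotC (ocomb_coef _ os).
Qed.

Definition oproj s v := ocomb s (fun t => f v (p t)).

Lemma Bessel s v : orthonormal_fam s ->
  \sum_(t <- s) f v (p t) * (f v (p t))^* <= f v v.
Proof.
move=> os; have := dnorm_ge0 f (v - oproj s v).
rewrite linearBr !linearBl /= (dot_ocomb _ _ os) [f v (oproj s v)]dotC dot_ocombl.
have -> : \sum_(t <- s) f v (p t) * f (p t) v = \sum_(t <- s) f v (p t) * (f v (p t))^*.
  by apply: eq_bigr => t _; rewrite -dotC.
set S := \sum_(t <- s) _.
have -> : S^* = S.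
  by rewrite rmorph_sum; apply: eq_bigr => t _; rewrite /= rmorphM /= conjCK mulrC.
by rewrite subrr subr0 subr_ge0.
Qed.

Lemma oproj_cons t s v : orthonormal_fam (t :: s) -> oproj s v = v -> oproj (t :: s) v = v.
Proof.
move=> [_ ts _] sv; rewrite /oproj /ocomb big_cons -{1}sv /oproj dot_ocombl.
rewrite [X in X *: _]big_seq [X in X *: _]big1 ?scale0r ?add0r// => u us.
by rewrite ts// mulr0.
Qed.

Lemma Gram_Schmidt s v : orthonormal_fam s -> oproj s v <> v -> exists e,
  [/\ f e e = 1, forall u, u \in s -> f (p u) e = 0 & f v e *: e + oproj s v = v].
Proof.
move=> os /eqP vs; pose w := v - oproj s v.
have w0 : w != 0 by rewrite subr_eq0 eq_sym.
pose a := sqrtC (f w w); have a0 : 0 < a by rewrite sqrtC_gt0 dnorm_gt0.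
have aR : (a^-1)^* = a^-1 by rewrite conj_Creal// rpredV gtr0_real.
have ws u : u \in s -> f (p u) w = 0.
  move=> us; rewrite linearBr /= [X in _ - X]dotC (ocomb_coef _ os us).
  by rewrite -dotC subrr.
have pw : f (oproj s v) w = 0.
  by rewrite dot_ocombl big_seq big1// => u us; rewrite ws// mulr0.
have vw : f v w = a ^+ 2 by rewrite sqrtCK {2}/w linearBl /= pw subr0.
exists (a^-1 *: w); split.
- rewrite linearZl_LR linearZr_LR /= aR -(sqrtCK (f w w)) -/a mulrA -invfM.
  by rewrite -expr2 mulVf// gt_eqF// exprn_gt0.
- by move=> u us; rewrite linearZr_LR /= ws// mulr0.
rewrite linearZr_LR /= aR vw scalerA -mulrA mulrCA -invfM -expr2 divff ?gt_eqF ?exprn_gt0//.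
by rewrite scale1r subrK.
Qed.

End orthonormal.

Section positivity.
Variables (R : realType) (n : nat) (V : lmodType R[i]) (f : {dot V for (@Num.conj R[i])}).
Variables (K : hilbertType R) (W : 'I_n -> {linear V -> V}).
Hypothesis K_inf : infinite_dim K.
Hypothesis W_contr : forall x : 'I_n -> V,
  f (\sum_i W i (x i)) (\sum_i W i (x i)) <= \sum_i f (x i) (x i).
Local Notation C := R[i].

Definition word_app (a : seq 'I_n) (v : V) : V := foldr (fun i x => W i x) v a.

Local Notation ofamV := (orthonormal_fam f (@fst V K)).
Local Notation ofamK := (orthonormal_fam (@inner R K) (@snd V K)).

(** Gram-Schmidt runs in [V] and [K] in parallel: each new direction needed in [V] is paired with a
    fresh unit vector of [K]. *)
Lemma orthonormal_exists (vs : seq V) : exists z : seq (V * K),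
  [/\ ofamV z, ofamK z & forall v, v \in vs -> oproj f (@fst V K) z v = v].
Proof.
elim: vs => [|v vs [z [zV zK zvs]]]; first by exists [::].
have [zv|zv] := pselect (oproj f (@fst V K) z v = v).
  by exists z; split=> // u; rewrite inE => /orP[/eqP->//|/zvs].
have [e [e1 ez ve]] := Gram_Schmidt zV zv.
(* If every [x] were its own projection, the finite family would span [K]. *)
have [x zx] : exists x, oproj (@inner R K) (@snd V K) z x <> x.
  apply/existsNP => zx; apply: K_inf; exists (map snd z) => x.
  exists (fun k => inner x (map snd z)`_k); rewrite -{1}(zx x) /oproj /ocomb.
  by rewrite -(big_map snd predT (fun k => inner x k *: k)) (big_nth 0) big_mkord.
have [k [k1 kz _]] := Gram_Schmidt zK zx.
have ezV : ofamV ((e, k) :: z) by [].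
exists ((e, k) :: z); split=> // u; rewrite inE => /orP[/eqP->|/zvs].
  by rewrite /oproj /ocomb big_cons.
exact: oproj_cons.
Qed.

Section compression.
Variables (z : seq (V * K)) (zV : ofamV z) (zK : ofamK z).

(** [to_K] projects onto the span in [V] and carries it isometrically to the span in [K]; [of_K] is
    its adjoint. *)
Definition to_K (v : V) : K := ocomb (@snd V K) z (fun t => f v t.1).
Definition of_K (x : K) : V := ocomb (@fst V K) z (fun t => inner x t.2).

Lemma to_K_sum I (r : seq I) (a : I -> C) (v : I -> V) :
  to_K (\sum_(i <- r) a i *: v i) = \sum_(i <- r) a i *: to_K (v i).
Proof.
rewrite /to_K /ocomb; under [RHS]eq_bigr do rewrite scaler_sumr.
rewrite exchange_big; apply: eq_bigr => t _ /=.
rewrite linear_sumlz scaler_suml; apply: eq_bigr => i _.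
by rewrite linearZl_LR scalerA.
Qed.

Lemma of_toK v : oproj f (@fst V K) z v = v -> of_K (to_K v) = v.
Proof.
move=> zv; rewrite -[RHS]zv /of_K /oproj /ocomb big_seq [RHS]big_seq.
by apply: eq_bigr => t tz; rewrite (ocomb_coef _ zK tz).
Qed.

Lemma inner_to_K v x : inner (to_K v) x = f v (of_K x).
Proof.
rewrite [RHS]dotC !dot_ocombl rmorph_sum; apply: eq_bigr => t _.
by rewrite /= rmorphM /= -dotC -innerC mulrC.
Qed.

Lemma norm_to_K v : inner (to_K v) (to_K v) <= f v v.
Proof. by rewrite (dot_ocomb _ _ zK); exact: Bessel. Qed.

Lemma norm_of_K x : f (of_K x) (of_K x) <= inner x x.
Proof. by rewrite (dot_ocomb _ _ zV); exact: (Bessel x zK). Qed.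

Lemma rank1_bounded (k w : K) : bounded_op (fun x : K => inner x k *: w).
Proof.
split=> [a x y|]; first by rewrite innerDl innerZl scalerDl scalerA.
exists (`|k| * `|w|) => x; rewrite normrZ mulrAC ler_wpM2r//.
by rewrite mulrC inner_norm_le.
Qed.

Definition rank1 k w : bop K K := mkbop (rank1_bounded k w).

(* [r W] compressed to the span of an orthonormal family of [V], transported to [K]. *)
Definition compression (r : R) (i : 'I_n) : bop K K :=
  r%:C%C *: \sum_(t <- z) rank1 t.2 (to_K (W i t.1)).

Lemma compressionE r i x : compression r i x = r%:C%C *: to_K (W i (of_K x)).
Proof.
change (r%:C%C *: (\sum_(t <- z) rank1 t.2 (to_K (W i t.1))) x = r%:C%C *: to_K (W i (of_K x))).
rewrite bop_sumE; congr (_ *: _).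
have -> : W i (of_K x) = \sum_(t <- z) inner x t.2 *: W i t.1.
  by rewrite /of_K /ocomb linear_sum; apply: eq_bigr => t _; rewrite linearZ.
by rewrite to_K_sum.
Qed.

Lemma row_norm_compression r : 0 <= r -> row_norm (compression r) <= r.
Proof.
move=> r0; apply: row_norm_le => // x; have r0' : 0 <= r%:C%C :> C by rewrite ler0c.
rewrite -[X in is_true X]ler_sqr ?nnegrE ?mulr_ge0// exprMn rowopE.
under eq_bigr do rewrite compressionE.
rewrite -scaler_sumr normrZ exprMn ger0_norm// ler_wpM2l ?exprn_ge0//.
have -> : \sum_i to_K (W i (of_K (x i))) = to_K (\sum_i W i (of_K (x i))).
  under eq_bigr do rewrite -[to_K _]scale1r.
  by rewrite -to_K_sum; congr to_K; apply: eq_bigr => i _; rewrite scale1r.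
rewrite !normsqE (le_trans (norm_to_K _))// (le_trans (W_contr _))//.
by rewrite ell2_innerE; apply: ler_sum => i _; exact: norm_of_K.
Qed.

(** Compression respects products only as long as no intermediate vector leaves the span, hence the
    condition on all suffixes of the word. *)
Lemma opword_compression r a v :
  (forall k, oproj f (@fst V K) z (word_app (drop k a) v) = word_app (drop k a) v) ->
  opword (compression r) a (to_K v) = (r%:C%C ^+ size a) *: to_K (word_app a v).
Proof.
elim: a => [|i a IH] av; first by rewrite scale1r.
have := av 1%N; rewrite /= drop0 => a1.
rewrite -[LHS]/(compression r i (opword (compression r) a (to_K v))).
rewrite IH => [|k]; last exact: (av k.+1).
have -> c k : compression r i (c *: k) = c *: compression r i k by exact: linearZ.
rewrite compressionE.
by rewrite of_toK// scalerA exprSr.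
Qed.

End compression.

Lemma ge0_at_1 (q : {poly R}) : (forall r, 0 < r -> r < 1 -> 0 <= q.[r]) -> 0 <= q.[1].
Proof.
move=> q0; rewrite leNgt; apply/negP => q1.
have e0 : 0 < - q.[1] by rewrite oppr_gt0.
have [d d0 dq] := polyrcf.poly_cont 1 q e0.
(* The minimum with 1 keeps [r] positive; halving keeps [r] strictly within [d] of 1. *)
pose r := 1 - Num.min d 1 / 2%:R.
have m0 : 0 < Num.min d 1 by rewrite lt_min d0 ltr01.
have m1 : Num.min d 1 <= 1 by rewrite ge_min lexx orbT.
have md : Num.min d 1 <= d by rewrite ge_min lexx.
have r1 : r < 1 by rewrite /r; lra.
have r0 : 0 < r by rewrite /r; lra.
have : `|r - 1| < d by rewrite distrC ger0_norm /r; lra.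
move=> /dq /ltr_normlP[_]; have := q0 _ r0 r1; lra.
Qed.

Lemma ncpoly_ge0 m (p : ncpoly R n m) (g : 'I_m -> V) :
  (forall X : 'I_n -> bop K K, row_norm X < 1 -> op_ge0 (op_Re (ncpoly_eval p X))) ->
  0 <= 'Re (\sum_i \sum_j \sum_(a <- finsupp p) p a i j * f (word_app a (g j)) (g i)).
Proof.
move=> p0.
(* All suffixes of words of [p] applied to the [g j], and the [g j] themselves, which must lie in
   the span even where [p] has no words. *)
pose vs := [seq word_app (drop ka.1 ka.2) (g j) | ka <-
   [seq (k, a) | a <- finsupp p, k <- iota 0 (size a).+1], j <- enum 'I_m] ++
   [seq g j | j <- enum 'I_m].
have [z [zV zK zvs]] := orthonormal_exists vs.
have good_g j : oproj f (@fst V K) z (g j) = g j.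
  by apply: zvs; rewrite mem_cat; apply/orP; right; apply: map_f; rewrite mem_enum.
have good j a k : a \in finsupp p ->
    oproj f (@fst V K) z (word_app (drop k a) (g j)) = word_app (drop k a) (g j).
  move=> ap; have [ka|ka] := leqP k (size a); last first.
    by rewrite drop_oversize ?(ltnW ka)//; exact: good_g.
  apply: zvs; rewrite mem_cat; apply/orP; left; apply/allpairsP.
  exists ((k, a), j); split; rewrite ?mem_enum//.
  apply/allpairsPdep; exists a, k; split=> //.
  by rewrite mem_iota.
(* The real part at the row shrunk by [r], as a polynomial in [r]. *)
pose q : {poly R} := \sum_i \sum_j \sum_(a <- finsupp p)
   complex.Re (p a i j * f (word_app a (g j)) (g i)) *: 'X^(size a).
have qE r : q.[r] = complex.Re (\sum_i \sum_j \sum_(a <- finsupp p)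
    r%:C%C ^+ size a * (p a i j * f (word_app a (g j)) (g i))).
  rewrite /q !raddf_sum horner_sum; apply: eq_bigr => i _.
  rewrite horner_sum raddf_sum; apply: eq_bigr => j _.
  rewrite horner_sum raddf_sum; apply: eq_bigr => a _.
  rewrite hornerZ hornerXn -rmorphXn mulrC /=.
  by move: (p a i j * _) => -[u v] /=; rewrite mul0r subr0.
have ReE' (x : C) : 'Re x = (complex.Re x)%:C%C by rewrite complexRe.
rewrite ReE' ler0c.
have -> : complex.Re (\sum_i \sum_j \sum_(a <- finsupp p)
    p a i j * f (word_app a (g j)) (g i)) = q.[1].
  rewrite qE; congr complex.Re; apply: eq_bigr => i _; apply: eq_bigr => j _; apply: eq_bigr => a _.
  by rewrite rmorph1 expr1n mul1r.
apply: ge0_at_1 => r r0 r1; rewrite qE -ler0c -ReE'.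
pose x : ell2 'I_m K := \sum_i single K i (to_K z (g i)).
have xE i : x i = to_K z (g i).
  rewrite ell2_sumE (bigD1 i)//= /single_fun eqxx big1 ?addr0// => j ji.
  by rewrite eq_sym (negPf ji).
have := p0 (compression z r) (le_lt_trans (row_norm_compression zV zK (ltW r0)) r1) x.
rewrite inner_op_Re inner_ncpoly_eval; congr (0 <= 'Re _).
apply: eq_bigr => i _; apply: eq_bigr => j _; rewrite big_seq [RHS]big_seq; apply: eq_bigr => a ap.
rewrite !xE opword_compression// => [|k]; last exact: good.
by rewrite innerZl inner_to_K of_toK// mulrCA.
Qed.

End positivity.

(** * Intertwining operators *)

Section extension.
Variables (R : realType).
Local Notation C := R[i].

Lemma bop_eq_dense (U V : normedModType C) (S : U -> Prop) (L L' : bop U V) :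
  (forall x, approx S x) -> (forall x, S x -> L x = L' x) -> L = L'.
Proof.
move=> dS LS; apply: bop_ext => x; apply: norm_small_eq => e e0.
have [M M0 LM] := bop_ge0_bound (L - L').
have M1 : 0 < M + 1 by rewrite ltr_wpDl.
have [y Sy xy] := dS x _ (divr_gt0 e0 M1).
have -> : L x - L' x = (L - L') (x - y).
  rewrite linearB; change (L x - L' x = L x - L' x - (L y - L' y)).
  by rewrite (LS y Sy) subrr subr0.
rewrite (le_trans (LM _))// (@le_trans _ _ ((M + 1) * `|x - y|))//.
  by rewrite ler_wpM2r// lerDl.
by rewrite mulrC -ler_pdivlMr// ltW.
Qed.

(** The map is given by a graph [G], as a vector of the span can be a combination of words in many
    ways. The bound, applied to differences, makes the graph and its closure [rel] single-valued. *)
Lemma bounded_extension (U V : hilbertType R) (G : U -> V -> Prop) (c : C) :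
  0 <= c -> (forall a x y x' y', G x y -> G x' y' -> G (a *: x + x') (a *: y + y')) ->
  (forall x y, G x y -> `|y| <= c * `|x|) ->
  (forall x, approx (fun x' => exists y, G x' y) x) ->
  exists L : bop U V, forall x y, G x y -> L x = y.
Proof.
move=> c0 Glin Gc Gd.
pose rel x z := forall e : C, 0 < e -> exists x' y', [/\ G x' y', `|x - x'| < e & `|z - y'| < e].
have Grel x y : G x y -> rel x y.
  by move=> Gxy e e0; exists x, y; rewrite !subrr !normr0.
have rel_lin a x z x' z' : rel x z -> rel x' z' -> rel (a *: x + x') (a *: z + z').
  move=> xz xz' e e0; have a1 : 0 < `|a| + 1 by rewrite ltr_wpDl.
  have e20 : 0 < e / 2%:R by rewrite divr_gt0.
  have [u [v [Guv xu zv]]] := xz _ (divr_gt0 e20 a1).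
  have [u' [v' [Guv' xu' zv']]] := xz' _ e20.
  have scal (Z : normedModType C) (p q p' q' : Z) : `|p - q| < e / 2%:R / (`|a| + 1) ->
      `|p' - q'| < e / 2%:R -> `|a *: p + p' - (a *: q + q')| < e.
    move=> pq pq'; rewrite opprD addrACA -scalerBr.
    rewrite (le_lt_trans (ler_normD _ _))// (splitr e) ler_ltD// normrZ.
    rewrite (@le_trans _ _ ((`|a| + 1) * `|p - q|)) ?ler_wpM2r ?lerDl//.
    by rewrite mulrC -ler_pdivlMr// ltW.
  by exists (a *: u + u'), (a *: v + v'); split; [exact: Glin|exact: scal|exact: scal].
have rel_bound x z : rel x z -> `|z| <= c * `|x|.
  move=> xz; apply/ler_addgt0Pr => e e0; have c1 : 0 < c + 1 by rewrite ltr_wpDl.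
  have [u [v [Guv xu zv]]] := xz _ (divr_gt0 e0 c1).
  rewrite -(subrK v z) (le_trans (ler_normD _ _))//.
  have ux : `|u| <= `|x| + `|x - u|.
    by rewrite -{1}(subKr x u) (le_trans (ler_normB _ _)).
  have cv : `|v| <= c * (`|x| + `|x - u|) by rewrite (le_trans (Gc _ _ Guv))// ler_wpM2l.
  rewrite (le_trans (lerD (ltW zv) cv))// mulrDr addrCA lerD2l.
  rewrite (le_trans (lerD (lexx _) (ler_wpM2l c0 (ltW xu))))//.
  rewrite -{1}[e / _]mul1r -mulrDl addrC mulrC divfK// gt_eqF//.
have rel_ex x : exists z, rel x z.
  have [d e y d0 de [x' [Gxy xx']]|e e0|e e0|z zP] := @shrinking_limit R V
    (fun e y => exists x', G x' y /\ `|x - x'| < e).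
  - by exists x'; split=> //; exact: lt_le_trans xx' de.
  - by have [x' [y Gxy] xx'] := Gd x e e0; exists y, x'.
  (* Two errors of this size, multiplied by [c], give [e * (c / (c + 1)) < e]; the [+ 1] admits
     [c = 0]. *)
  - have c1 : 0 < 2%:R * (c + 1) by rewrite mulr_gt0// ltr_wpDl.
    exists (e / (2%:R * (c + 1))) => [|y y' [x1 [G1 x1x]] [x2 [G2 x2x]]]; first exact: divr_gt0.
    have := Glin (-1) _ _ _ _ G2 G1; rewrite !scaleN1r ![- _ + _]addrC => /Gc yc.
    rewrite (le_lt_trans yc)//.
    have -> : x1 - x2 = (x - x2) - (x - x1) by vring.
    apply: (@le_lt_trans _ _ (c * (e / (2%:R * (c + 1)) + e / (2%:R * (c + 1))))).
      by rewrite ler_wpM2l// (le_trans (ler_normB _ _))// lerD// ltW.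
    have c1' : 0 < c + 1 by rewrite ltr_wpDl.
    have -> : c * (e / (2%:R * (c + 1)) + e / (2%:R * (c + 1))) = e * (c / (c + 1)).
      by field; rewrite gt_eqF.
    by rewrite gtr_pMr// ltr_pdivrMr// mul1r ltrDl ltr01.
  exists z => e /zP[y [[x' [Gxy xx']] zy]]; by exists x', y.
pose L x := projT1 (cid (rel_ex x)).
have LP x : rel x (L x) by rewrite /L; case: cid.
have rel_fun x z z' : rel x z -> rel x z' -> z = z'.
  move=> xz xz'; have := rel_bound _ _ (rel_lin (-1) _ _ _ _ xz' xz).
  rewrite !scaleN1r addNr normr0 mulr0 normr_le0 addrC subr_eq0 => /eqP//.
have Lb : bounded_op L.
  split=> [a x y|]; last by exists c => x; exact: rel_bound.
  by apply: rel_fun (LP _) _; exact: rel_lin.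
by exists (mkbop Lb) => x y /Grel; exact: rel_fun.
Qed.

End extension.

Section intertwining.
Variables (R : realType) (n : nat) (H KA KB : hilbertType R).
Variables (V : 'I_n -> bop KA KA) (W : 'I_n -> bop KB KB) (jA : bop H KA) (jB : bop H KB).
Local Notation C := R[i].

Definition intertwines (L : bop KB KA) : Prop :=
  (forall h, L (jB h) = jA h) /\ forall i x, L (W i x) = V i (L x).

Lemma intertwines_word L a h : intertwines L -> L (opword W a (jB h)) = opword V a (jA h).
Proof. by move=> [Lh LW]; elim: a => [|i a IH] /=; rewrite ?Lh// LW IH. Qed.

Section dense.
Hypothesis W_dense : forall x, approx (word_span W jB) x.

Lemma intertwines_unique L L' : intertwines L -> intertwines L' -> L = L'.
Proof.
move=> LL LL'; apply: (bop_eq_dense W_dense) => x [s ->].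
rewrite /word_comb !linear_sum; apply: eq_bigr => t _ /=.
by rewrite !intertwines_word.
Qed.

Lemma intertwines_exists (c : C) : 0 < c ->
  (forall s, `|word_comb V jA s| <= c * `|word_comb W jB s|) -> exists L, intertwines L.
Proof.
move=> c0 AB.
pose G x y := exists s, x = word_comb W jB s /\ y = word_comb V jA s.
have [||||L LG] := @bounded_extension R KB KA G c.
- exact: ltW.
- move=> a x y x' y' [s [-> ->]] [s' [-> ->]].
  by exists ([seq (t.1, a *: t.2) | t <- s] ++ s'); rewrite !word_comb_cat !word_comb_scale.
- by move=> x y [s [-> ->]].
- move=> x e e0; have [_ [s ->] xs] := W_dense x e0.
  by exists (word_comb W jB s) => //; exists (word_comb V jA s), s.
have Lw s : L (word_comb W jB s) = word_comb V jA s by apply: LG; exists s.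
exists L; split=> [h|i x].
  by have := Lw [:: ([::], h)]; rewrite !word_comb1.
suff /(congr1 (fun S : bop KB KA => S x)) : compop L (W i) = compop (V i) L by [].
apply: (bop_eq_dense W_dense) => _ [s ->].
by rewrite /= Lw !word_comb_step Lw.
Qed.

End dense.

Lemma intertwines_adj L i x : intertwines L -> adj (W i) (adj L x) = adj L (adj (V i) x).
Proof.
move=> [_ LW]; have : adj (compop L (W i)) = adj (compop (V i) L).
  by congr adj; apply: bop_ext => y; exact: LW.
by rewrite !adj_comp => /(congr1 (fun S : bop KA KB => S x)).
Qed.

End intertwining.

(* With [c] larger than the norm of [L], [gap_form] is again an inner product,
   for which a row of isometries commuting with [L] is still isometric. *)
Section gap_form.
Variables (R : realType) (KA KB : hilbertType R) (L : bop KB KA) (c : R[i]).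
Local Notation C := R[i].
Hypothesis c_gt : forall x, x != 0 -> `|L x| ^+ 2 < c * `|x| ^+ 2.
Hypothesis c_real : c^* = c.

Definition gap_form (x y : KB) : C := c * inner x y - inner (L x) (L y).

Lemma gap_form_bilinear : bilinear_for *%R ((@Num.conj C) \; *%R) gap_form.
Proof.
have LP z x y : L (z *: x + y) = z *: L x + L y by exact: linearP.
split=> [z a x y|z a x y]; rewrite /gap_form LP.
  by rewrite /= !innerDl !innerZl; ring.
by rewrite /= !innerDr !innerZr; ring.
Qed.
HB.instance Definition _ := bilinear_isBilinear.Build C KB KB C
  *%R ((@Num.conj C) \; *%R) gap_form gap_form_bilinear.

Lemma gap_form_herm (x y : KB) : gap_form x y = (-1) ^+ false * (gap_form y x)^*.
Proof. by rewrite expr0 mul1r /gap_form rmorphB rmorphM /= c_real -!innerC. Qed.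
HB.instance Definition _ := isHermitianSesquilinear.Build C KB false
  (@Num.conj C) gap_form gap_form_herm.

Lemma gap_form_gt0 (x : KB) : x != 0 -> 0 < gap_form x x.
Proof. by move=> /c_gt; rewrite /gap_form -!normsqE subr_gt0. Qed.
HB.instance Definition _ := isDotProduct.Build C KB gap_form gap_form_gt0.

Definition gap_dot : {dot KB for (@Num.conj C)} := gap_form.

End gap_form.

Section harnack.
Variables (R : realType) (n : nat) (K H KA KB : hilbertType R).
Variables (A B : 'I_n -> bop H H).
Variables (V : 'I_n -> bop KA KA) (W : 'I_n -> bop KB KB) (jA : bop H KA) (jB : bop H KB).
Local Notation C := R[i].
Hypothesis K_inf : infinite_dim K.
Hypothesis V_isom : forall i j x y, inner (V i x) (V j y) = (i == j)%:R * inner x y.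
Hypothesis W_isom : forall i j x y, inner (W i x) (W j y) = (i == j)%:R * inner x y.
Hypothesis V_compr : forall a h k, inner (opword V a (jA h)) (jA k) = inner (opword A a h) k.
Hypothesis W_compr : forall a h k, inner (opword W a (jB h)) (jB k) = inner (opword B a h) k.

Lemma intertwines_harnack L : intertwines V W jA jB L -> harnack_le K A B.
Proof.
move=> LI; have [M M0 LM] := bop_ge0_bound L.
(* The [+ 1] makes the gap form definite rather than semidefinite. The same [c] is the constant of
   the domination. *)
pose c := M + 1; have c0 : 0 < c by rewrite ltr_wpDl.
pose r := complex.Re c; have cE : c = r%:C%C by apply: ge0_RRe; exact: ltW.
have r0 : 0 < r by rewrite -ltcR -cE.
have c2 : (c ^+ 2)^* = c ^+ 2 by rewrite conj_Creal// rpredX// gtr0_real.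
have c_gt x : x != 0 -> `|L x| ^+ 2 < c ^+ 2 * `|x| ^+ 2.
  move=> x0; rewrite -exprMn ltr_sqr ?nnegrE ?normr_ge0 ?mulr_ge0 ?(ltW c0)//.
  apply: le_lt_trans (LM x) _; by rewrite ltr_pM2r ?normr_gt0// ltrDl.
exists r; split=> // m p p0.
have -> : (r ^+ 2)%:C%C = c ^+ 2 by rewrite cE rmorphXn.
apply/op_le_Re => [|x]; first by rewrite rpredX// gtr0_real.
pose f := gap_dot c_gt c2.
have fW i j u v : f (W i u) (W j v) = (i == j)%:R * f u v.
  case: LI => _ LW; change (c ^+ 2 * inner (W i u) (W j v) - inner (L (W i u)) (L (W j v)) =
    (i == j)%:R * (c ^+ 2 * inner u v - inner (L u) (L v))).
  by rewrite !LW V_isom W_isom; ring.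
have W_contr (y : 'I_n -> KB) : f (\sum_i W i (y i)) (\sum_i W i (y i)) <= \sum_i f (y i) (y i).
  rewrite linear_sumlz le_eqVlt; apply/orP; left; apply/eqP; apply: eq_bigr => i _.
  rewrite linear_sumr (bigD1 i)//= fW eqxx mul1r big1 ?addr0// => j ji.
  by rewrite fW eq_sym (negPf ji) mul0r.
have := @ncpoly_ge0 R n KB f K W K_inf W_contr m p (fun i => jB (x i)) p0.
rewrite !inner_ncpoly_eval -[X in _ -> is_true X]subr_ge0; congr (0 <= _).
have c2R : c ^+ 2 \is Num.real by rewrite rpredX// gtr0_real.
rewrite -[c ^+ 2 * 'Re _]ReMl// -raddfB /=; congr ('Re _).
rewrite mulr_sumr -sumrB; apply: eq_bigr => i _.
rewrite mulr_sumr -sumrB; apply: eq_bigr => j _.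
rewrite mulr_sumr -sumrB; apply: eq_bigr => a _.
have -> : word_app (fun l => W l) a (jB (x j)) = opword W a (jB (x j)).
  by elim: (a) => //= l b ->.
(* The first term compresses to [B]; in the second, [L] turns words in [W] into words in [V], which
   compress to [A]. *)
change (p a i j * (c ^+ 2 * inner (opword W a (jB (x j))) (jB (x i)) -
  inner (L (opword W a (jB (x j)))) (L (jB (x i)))) =
  c ^+ 2 * (p a i j * inner (opword B a (x j)) (x i)) - p a i j * inner (opword A a (x j)) (x i)).
rewrite W_compr (intertwines_word _ _ LI) (proj1 LI) V_compr; ring.
Qed.

End harnack.

(* The shape of the adjoints of a minimal isometric dilation: [d] stands for the
   restriction of [Delta] to the defect space. *)
Definition adj_dilation_shape (R : realType) (n : nat) (H D : hilbertType R)
    (T : 'I_n -> bop H H) (d : bop D (ell2 'I_n H))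
    (V : 'I_n -> bop (dsum H (fock n D)) (dsum H (fock n D))) : Prop :=
  forall i x, adj (V i) x = (adj (T i) x.1 + d (x.2 [::]) i, adj (lcreate D i) x.2).

Section entries.
Variables (R : realType) (n : nat) (H DA DB : hilbertType R) (A B : 'I_n -> bop H H).
Variables (dA : bop DA (ell2 'I_n H)) (dB : bop DB (ell2 'I_n H)).
Local Notation C := R[i].
Local Notation KA := (dsum H (fock n DA)).
Local Notation KB := (dsum H (fock n DB)).
Variables (V : 'I_n -> bop KA KA) (W : 'I_n -> bop KB KB).
Hypotheses (VE : adj_dilation_shape A dA V) (WE : adj_dilation_shape B dB W).

(* [Omega] and [Theta] are the entries of an operator [M = [1, 0; Omega, Theta]];
   these are the entries of the equations [W_i^* M = M V_i^*]. *)
Definition entries_intertwine (Om : bop H (fock n DB)) (Th : bop (fock n DA) (fock n DB)) : Prop :=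
  [/\ forall h i, dB (Om h [::]) i = adj (A i) h - adj (B i) h,
      forall h i, adj (lcreate DB i) (Om h) = Om (adj (A i) h),
      forall xi, dB (Th xi [::]) = dA (xi [::])
    & forall xi i, adj (lcreate DB i) (Th xi) =
        Om (dA (xi [::]) i) + Th (adj (lcreate DA i) xi)].

Local Notation intertwines := (intertwines V W (dinl H (fock n DA)) (dinl H (fock n DB))).

Lemma intertwines_entries L : intertwines L -> exists Om Th, entries_intertwine Om Th.
Proof.
move=> LI; pose M := adj L.
exists (compop (dsnd H (fock n DB)) (compop M (dinl H (fock n DA)))).
exists (compop (dsnd H (fock n DB)) (compop M (dinr H (fock n DA)))).
(* The first row of the adjoint is [[1, 0]] because [L] fixes [H]. *)
have M1 (x : KA) : (M x).1 = x.1.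
  apply: inner_eqr => h; have := adjE L (dinl H (fock n DB) h) x.
  by rewrite (proj1 LI) !dsum_innerE /= !inner0l !addr0.
have M1V i (x : KA) : adj (B i) x.1 + dB ((M x).2 [::]) i = adj (A i) x.1 + dA (x.2 [::]) i.
  by have := congr1 fst (intertwines_adj i x LI); rewrite M1 WE VE /= M1.
have M2V i (x : KA) : adj (lcreate DB i) (M x).2 =
    (M (adj (A i) x.1 + dA (x.2 [::]) i, adj (lcreate DA i) x.2)).2.
  by have := congr1 snd (intertwines_adj i x LI); rewrite WE VE.
have MD (x : KA) : (M x).2 = (M (dinl H (fock n DA) x.1)).2 + (M (dinr H (fock n DA) x.2)).2.
  by rewrite {1}(dsum_decomp x) linearD.
split.
- move=> h i; have := M1V i (dinl H (fock n DA) h).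
  change (adj (B i) h + dB ((M (dinl H (fock n DA) h)).2 [::]) i = adj (A i) h + dA 0 i ->
    dB ((M (dinl H (fock n DA) h)).2 [::]) i = adj (A i) h - adj (B i) h).
  rewrite linear0 => E.
  have {}E : adj (B i) h + dB ((M (dinl H (fock n DA) h)).2 [::]) i = adj (A i) h.
    by rewrite E; exact: addr0.
  by rewrite -E addrAC subrr add0r.
- move=> h i; have := M2V i (dinl H (fock n DA) h).
  change (adj (lcreate DB i) (M (dinl H (fock n DA) h)).2 =
      (M (adj (A i) h + dA 0 i, adj (lcreate DA i) 0)).2 ->
    adj (lcreate DB i) (M (dinl H (fock n DA) h)).2 = (M (adj (A i) h, 0)).2).
  have -> : dA 0 i = 0 by rewrite linear0.
  by rewrite addr0 linear0.
- move=> xi; apply: ell2_ext => i; have := M1V i (dinr H (fock n DA) xi).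
  change (adj (B i) 0 + dB ((M (dinr H (fock n DA) xi)).2 [::]) i = adj (A i) 0 + dA (xi [::]) i ->
    dB ((M (dinr H (fock n DA) xi)).2 [::]) i = dA (xi [::]) i).
  by rewrite !linear0 !add0r.
- move=> xi i; have := M2V i (dinr H (fock n DA) xi).
  change (adj (lcreate DB i) (M (dinr H (fock n DA) xi)).2 =
     (M (adj (A i) 0 + dA (xi [::]) i, adj (lcreate DA i) xi)).2 ->
    adj (lcreate DB i) (M (dinr H (fock n DA) xi)).2 =
    (M (dinl H (fock n DA) (dA (xi [::]) i))).2 +
    (M (dinr H (fock n DA) (adj (lcreate DA i) xi))).2).
  by rewrite linear0 add0r => ->; exact: MD.
Qed.

(** [L] is the adjoint of the block matrix [M], so its intertwining relations follow from the
    entries of [W_i^* M = M V_i^*]. *)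
Lemma entries_intertwines Om Th : entries_intertwine Om Th -> exists L : bop KB KA,
  intertwines L /\ forall h xi, adj L (h, xi) = (h, Om h + Th xi).
Proof.
move=> [a b c d].
pose M : bop KA KB := compop (dinl H (fock n DB)) (dfst H (fock n DA)) +
  compop (dinr H (fock n DB)) (compop Om (dfst H (fock n DA)) + compop Th (dsnd H (fock n DA))).
have ME x : M x = (x.1, Om x.1 + Th x.2).
  change ((x.1 + 0, 0 + (Om x.1 + Th x.2)) = (x.1, Om x.1 + Th x.2) :> KB).
  by rewrite addr0 add0r.
exists (adj M); split; last by move=> h xi; rewrite adjK ME.
split=> [h|i x].
  by apply: inner_eq => y; rewrite adjEr ME !dsum_innerE /= !inner0l.
suff WM y : adj (W i) (M y) = M (adj (V i) y).
  by apply: inner_eq => y; rewrite adjEr adjE WM [RHS]adjE adjEr.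
rewrite WE VE !ME; congr pair.
  change (adj (B i) y.1 + dB ((Om y.1 + Th y.2) [::]) i = adj (A i) y.1 + dA (y.2 [::]) i).
  have -> : dB ((Om y.1 + Th y.2) [::]) = dB (Om y.1 [::]) + dB (Th y.2 [::]) := linearD dB _ _.
  rewrite c.
  change (adj (B i) y.1 + (dB (Om y.1 [::]) i + dA (y.2 [::]) i) = adj (A i) y.1 + dA (y.2 [::]) i).
  by rewrite a addrA [adj (B i) _ + _]addrC subrK.
change (adj (lcreate DB i) (Om y.1 + Th y.2) =
  Om (adj (A i) y.1 + dA (y.2 [::]) i) + Th (adj (lcreate DA i) y.2)).
have -> : adj (lcreate DB i) (Om y.1 + Th y.2) =
  adj (lcreate DB i) (Om y.1) + adj (lcreate DB i) (Th y.2) := linearD _ _ _.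
have -> : Om (adj (A i) y.1 + dA (y.2 [::]) i) =
  Om (adj (A i) y.1) + Om (dA (y.2 [::]) i) := linearD Om _ _.
by rewrite b d addrA.
Qed.

End entries.

(** * Fourier coefficients *)

Section fock_sums.
Variables (R : realType) (n : nat) (E : hilbertType R).
Local Notation C := R[i].
Implicit Types (f w : fock n E).

Lemma fock_cvg f : ((fun S : {fset seq 'I_n} => \sum_(a <- S) e_tensor E a (f a))
  @ summability.totally --> f)%classic.
Proof.
apply/cvgrPdist_lt => e e0; have [A Af] := ell2_trunc f e0.
exists A => //= S AS; apply: Af => a; rewrite sum_e_tensorE.
  by case: ifP => _; [left|right].
by move=> /(fsubsetP AS) ->.
Qed.

Lemma fock_cvg_coef (u : seq 'I_n -> E) w :
  ((fun S : {fset seq 'I_n} => \sum_(a <- S) e_tensor E a (u a))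
    @ summability.totally --> w)%classic -> forall a, w a = u a.
Proof.
move=> uw a; apply: norm_small_eq => e e0.
move/cvgrPdist_lt: uw => /(_ _ e0) [A _ AP].
have /= /ltW wS := AP (A `|` [fset a])%fset (fsubsetUl _ _); apply: le_trans wS.
set g := \sum_(_ <- _) _.
have -> : u a = g a by rewrite sum_e_tensorE !inE eqxx orbT.
exact: (ell2_norm_ge (w - g)).
Qed.

Lemma fock_series_cvg f (g : nat -> fock n E) :
  (forall k a, g k a = if size a == k then f a else 0) ->
  (series g @ \oo --> f)%classic.
Proof.
move=> gf; apply/cvgrPdist_lt => e e0; have [A Af] := ell2_trunc f e0.
(* From this index on, the partial sum, which keeps the words shorter than [N], contains all of
   [A]. *)
exists (\max_(a <- A) size a).+1 => // N /= AN.
have sE a : series g N a = if (size a < N)%N then f a else 0.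
  rewrite /series /= ell2_sumE; under eq_bigr do rewrite gf.
  rewrite -big_mkcond (eq_bigl (fun k => k == size a)) => [|k]; last exact: eq_sym.
  by rewrite big_nat1_eq.
apply: Af => a; rewrite sE; first by case: ifP => _; [left|right].
by move=> aA; rewrite (leq_ltn_trans _ AN)// (leq_bigmax_seq (F := size)).
Qed.

Lemma adj_lcreate_sum i (g : 'I_n -> fock n E) :
  adj (lcreate E i) (\sum_j lcreate E j (g j)) = g i.
Proof.
apply: ell2_ext => a; rewrite adj_lcreateE ell2_sumE (bigD1 i)//= big1 ?addr0.
  by rewrite /shift_fun /= eqxx.
by move=> j ji; rewrite /shift_fun /= eq_sym (negPf ji).
Qed.

Lemma strip_last_rcons (i j : 'I_n) a :
  strip_last j (rcons a i) = if i == j then Some a else None.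
Proof. by case: a => //= b a; rewrite last_rcons belast_rcons. Qed.

End fock_sums.

Section Omega_series.
Variables (R : realType) (n : nat) (H : hilbertType R) (A : 'I_n -> bop H H).
Local Notation C := R[i].

(** [R_j] appends a letter, so the induction removes the last one, in step with
    [A_(a j)^* = A_j^* A_a^*]. *)
Lemma iter_sumRA k h a : iter k (sumRA A) (e_tensor H [::] h) a =
  if size a == k then adj (opword A a) h else 0.
Proof.
elim: k a => [|k IH] a.
  by rewrite /= /single_fun size_eq0; case: eqP => // ->; rewrite /= adj_idop.
rewrite iterS; set f := iter k _ _ in IH *.
rewrite /sumRA bop_sumE ell2_sumE.
case/lastP: a => [|a i]; first by rewrite big1.
rewrite (bigD1 i)//= big1 ?addr0 => [|j ji].
  rewrite /shift_fun strip_last_rcons eqxx /= IH size_rcons eqSS.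
  by case: ifP => _; rewrite ?linear0// adj_opword_rcons.
by rewrite /shift_fun strip_last_rcons eq_sym (negPf ji).
Qed.

Variables (E : hilbertType R) (Om0 : bop H E) (Om : bop H (fock n E)).

Lemma Omega_coef_cvg h : (forall a, Om h a = Om0 (adj (opword A a) h)) ->
  (series (fun k => amplify (seq 'I_n) Om0 (iter k (sumRA A) (e_tensor H [::] h))) @ \oo
     --> Om h)%classic /\
  ((fun S : {fset seq 'I_n} => \sum_(a <- S) e_tensor E a (Om0 (adj (opword A a) h)))
      @ summability.totally --> Om h)%classic.
Proof.
move=> Oh; split.
  apply: fock_series_cvg => k a; rewrite Oh.
  rewrite -[LHS]/(Om0 (iter k (sumRA A) (e_tensor H [::] h) a)) iter_sumRA.
  by case: ifP; rewrite ?linear0.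
under eq_fun do under eq_bigr do rewrite -Oh.
exact: fock_cvg.
Qed.

End Omega_series.

Section formal_series.
Variables (R : realType) (n : nat).
Local Notation C := R[i].

Lemma sum_frgen (E G : hilbertType R) (T : 'I_n -> bop E G) (g : seq 'I_n) :
  \sum_i frgen i (T i) g = if g is [:: i] then T i else 0.
Proof.
rewrite /frgen; case: g => [|i [|j g]]; try by rewrite big1.
  rewrite (bigD1 i)//= eqxx big1 ?addr0// => j ji.
  by rewrite eqseq_cons eq_sym (negPf ji).
by rewrite big1// => k _; rewrite eqseq_cons andbF.
Qed.

Lemma comp0op (E F G : hilbertType R) (T : bop E F) : compop (0 : bop F G) T = 0.
Proof. exact: bop_ext. Qed.

Lemma compop0 (E F G : hilbertType R) (T : bop F G) : compop T (0 : bop E F) = 0.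
Proof. by apply: bop_ext => x; rewrite /= linear0. Qed.

Variables (E F G : hilbertType R).

Lemma fmul_const (T : bop F G) (a : fseries n E F) g :
  fmul (fconst T) a g = compop T (a g).
Proof.
rewrite /fmul big_ord_recl take0 drop0 /fconst eqxx big1 ?addr0// => k _.
rewrite /=; case: g k => [[]//|i g k] /=; exact: comp0op.
Qed.

Lemma fmul_singl_cons (T : 'I_n -> bop F G) (b : fseries n F G) (a : fseries n E F) i g :
  (forall g, b g = if g is [:: i] then T i else 0) ->
  fmul b a (i :: g) = compop (T i) (a g).
Proof.
move=> bE; rewrite /fmul big_ord_recl take0 bE comp0op add0r big_ord_recl /=.
rewrite take0 drop0 bE big1 ?addr0// => k _.
by rewrite bE /=; case: g k => [[]//|j g k] /=; exact: comp0op.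
Qed.

Lemma fmul_singl_nil (T : 'I_n -> bop F G) (b : fseries n F G) (a : fseries n E F) :
  (forall g, b g = if g is [:: i] then T i else 0) -> fmul b a [::] = 0.
Proof. by move=> bE; rewrite /fmul big_ord1 /= bE comp0op. Qed.

Lemma fmul_singr_rcons (T : 'I_n -> bop E F) (b : fseries n F G) (a : fseries n E F) i g :
  (forall g, a g = if g is [:: i] then T i else 0) ->
  fmul b a (rcons g i) = compop (b g) (T i).
Proof.
move=> aE; rewrite /fmul size_rcons big_ord_recr /= drop_oversize ?size_rcons//.
rewrite aE compop0 addr0 big_ord_recr /=.
rewrite -cats1 take_size_cat// drop_size_cat// aE big1 ?add0r// => k _.
rewrite drop_cat ltn_ord aE.
have : (0 < size (drop k g))%N by rewrite size_drop subn_gt0.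
by case: (drop k g) => // j [|l g'] _ /=; exact: compop0.
Qed.

Lemma fmul_singr_nil (T : 'I_n -> bop E F) (b : fseries n F G) (a : fseries n E F) :
  (forall g, a g = if g is [:: i] then T i else 0) -> fmul b a [::] = 0.
Proof. by move=> aE; rewrite /fmul big_ord1 /= aE compop0. Qed.

End formal_series.

(** Here [R_i R_g] comes with [T_i^*] in front, and the product of adjoints along [g] is the adjoint
    of the reversed word. Only the power of exponent [size g] has a coefficient at [g]. *)
Lemma fgeom_adj (R : realType) (n : nat) (H : hilbertType R) (T : 'I_n -> bop H H) g :
  fgeom (fun b => \sum_j frgen j (adj (T j)) b) g = adj (opword T (rev g)).
Proof.
set a : fseries n H H := fun b => _; have aE b : a b = if b is [:: i] then adj (T i) else 0.
  by rewrite /a sum_frgen.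
have fE k g' : fexp a k g' = if size g' == k then adj (opword T (rev g')) else 0.
  elim: k g' => [|k IH] g'.
    by rewrite /= /fconst size_eq0; case: eqP => // ->; rewrite adj_idop.
  rewrite /fexp iterS -/(fexp a k); case: g' => [|i g']; first by rewrite (fmul_singl_nil _ aE).
  rewrite (fmul_singl_cons _ _ _ aE) IH /= eqSS; case: ifP => _; last exact: compop0.
  apply: bop_ext => x; by rewrite /= rev_cons adj_opword_rcons.
rewrite /fgeom (bigD1 ord_max)//= fE eqxx big1 ?addr0// => k kg.
rewrite fE; case: eqP => // gk; case/eqP: kg; exact: val_inj.
Qed.

Section coefficients.
Variables (R : realType) (n : nat) (H DA DB : hilbertType R) (A B : 'I_n -> bop H H).
Variables (dA : bop DA (ell2 'I_n H)) (dB : bop DB (ell2 'I_n H)).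
Local Notation C := R[i].
Hypothesis dB_inj : injective dB.

(** Conditions (i)-(iv) coefficient by coefficient, the series in (iv) being read off the image of
    the vacuum. *)
Definition coef_conditions (Om0 : bop H DB) (Th0 : bop DA DB)
    (Om : bop H (fock n DB)) (Th : bop (fock n DA) (fock n DB)) : Prop :=
  [/\ forall h i, dB (Om0 h) i = adj (A i) h - adj (B i) h,
      forall h a, Om h a = Om0 (adj (opword A a) h),
      forall x, dA x = dB (Th0 x)
    & [/\ multi_analytic Th, forall x, Th (e_tensor DA [::] x) [::] = Th0 x
      & forall x i a, Th (e_tensor DA [::] x) (i :: a) = Om0 (adj (opword A a) (dA x i))]].

Lemma coef_conditions_entries Om0 Th0 Om Th : coef_conditions Om0 Th0 Om Th ->
  entries_intertwine A B dA dB Om Th.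
Proof.
move=> [c1 c2 c3 [ma t0 ti]].
have ThS i f : Th (lcreate DA i f) = lcreate DB i (Th f).
  exact: (congr1 (fun S : bop (fock n DA) (fock n DB) => S f) (ma i)).
(* Multi-analyticity reduces [Th] to its values on the vacuum. *)
have ThE f : Th f = Th (e_tensor DA [::] (f [::])) +
    \sum_i lcreate DB i (Th (adj (lcreate DA i) f)).
  rewrite {1}(fock_decomp f) linearD linear_sum; congr (_ + _).
  by apply: eq_bigr => i _; exact: ThS.
have Om_nil h : Om h [::] = Om0 h by rewrite c2 /= adj_idop.
split.
- by move=> h i; rewrite Om_nil.
- move=> h i; apply: ell2_ext => a.
  by rewrite adj_lcreateE !c2 adj_opword_cons.
- move=> f; rewrite c3 -t0; congr (dB _).
  rewrite ThE -[LHS]/(Th (e_tensor DA [::] (f [::])) [::] +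
    (\sum_i lcreate DB i (Th (adj (lcreate DA i) f))) [::]).
  by rewrite ell2_sumE big1 ?addr0.
move=> f i; rewrite {1}ThE.
have -> u v : adj (lcreate DB i) (u + v) =
  adj (lcreate DB i) u + adj (lcreate DB i) v := linearD _ u v.
rewrite adj_lcreate_sum.
by congr (_ + _); apply: ell2_ext => a; rewrite adj_lcreateE ti c2.
Qed.

Lemma entries_coef_conditions Om Th : entries_intertwine A B dA dB Om Th ->
  coef_conditions (compop (component DB [::]) Om)
    (compop (component DB [::]) (compop Th (e_tensor DA [::]))) Om Th.
Proof.
move=> [e1 e2 e3 e4].
have OmE h a : Om h a = Om (adj (opword A a) h) [::].
  elim: a h => [|i a IH] h; first by rewrite /= adj_idop.
  by rewrite -adj_lcreateE e2 IH adj_opword_cons.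
(* Injectivity of [dB] is what makes the vacuum coefficient of [Th f] depend on that of [f]
   alone. *)
have Th_nil f : Th f [::] = Th (e_tensor DA [::] (f [::])) [::].
  by apply: dB_inj; rewrite !e3 e_tensor_eq.
split=> //.
  by move=> x; rewrite /= e3 e_tensor_eq.
split=> [i|//|x i a].
  (* [S_i f] has no vacuum component, so the term with [Om] in the recursion drops out. *)
  apply: bop_ext => f; rewrite -[LHS]/(Th (lcreate DA i f)) -[RHS]/(lcreate DB i (Th f)).
  apply: ell2_ext => -[|j a].
    by rewrite Th_nil !lcreate_nil !linear0.
  rewrite -!adj_lcreateE e4 lcreate_nil !adj_lcreate_lcreate.
  have -> : dA 0 j = 0 by rewrite linear0.
  by rewrite linear0 add0r linearZ.
rewrite -adj_lcreateE e4 e_tensor_eq.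
have -> : adj (lcreate DA i) (e_tensor DA [::] x) = 0.
  by apply: ell2_ext => b; rewrite adj_lcreateE.
by rewrite linear0 addr0 OmE.
Qed.

End coefficients.

(** * The defect operator and the conditions of the theorem *)

Section Delta.
Variables (R : realType) (n : nat) (H : hilbertType R) (T : 'I_n -> bop H H).
Hypothesis T_contr : row_norm T <= 1.
Local Notation C := R[i].
Local Notation D := (defect_space T).

Lemma Delta_sym f g : inner (Delta T f) g = inner f (Delta T g).
Proof. by have [D0 _] := DeltaP T_contr; exact: op_ge0_sym. Qed.

(** The kernel of a self-adjoint operator is orthogonal to the closure of its range, so an element
    of both is orthogonal to itself. *)
Lemma Delta_inj (d d' : D) : Delta T (val d) = Delta T (val d') -> d = d'.
Proof.
move=> dd; apply/eqP; rewrite -subr_eq0; apply/eqP; set u := d - d'.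
have u0 : Delta T (val u) = 0.
  by rewrite -[val u]/(val d - val d') linearB /= dd subrr.
clearbody u; apply: (@norm_small_eq R D) => e e0; rewrite subr0 clrange_norm.
have /clrangeP/(_ _ e0)[f uf] := valP u.
apply: norm_le_of_sqr => //; first exact: ltW.
rewrite normsqE.
have -> : inner (val u) (val u) = inner (val u - Delta T f) (val u).
  by rewrite [RHS]innerBl Delta_sym u0 inner0r subr0.
rewrite -[leLHS]ger0_norm; last by rewrite innerBl Delta_sym u0 inner0r subr0 -normsqE exprn_ge0.
by rewrite (le_trans (inner_norm_le _ _))// ler_wpM2r// ltW.
Qed.

Lemma adj_dilopE i (x : dilation_space T) : adj (dilop T_contr i) x =
  (adj (T i) x.1 + Delta T (val (x.2 [::])) i, adj (lcreate D i) x.2).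
Proof.
apply: inner_eqr => y; rewrite -adjE.
change (inner (T i y.1) x.1 + inner (Ddefect T i y.1 + lcreate D i y.2) x.2 =
  inner y.1 (adj (T i) x.1 + Delta T (val (x.2 [::])) i) + inner y.2 (adj (lcreate D i) x.2)).
rewrite innerDl innerDr -adjE [inner (lcreate _ _ _) _]adjE -addrA; congr (_ + (_ + _)).
rewrite inner_singlel -[LHS]/(inner (Delta T (single H i y.1)) (val (x.2 [::]))).
by rewrite Delta_sym inner_singlel.
Qed.

End Delta.

Section conditions.
Variables (R : realType) (n : nat) (H : hilbertType R) (A B : 'I_n -> bop H H).
Local Notation C := R[i].

Definition Delta_defect (T : 'I_n -> bop H H) : bop (defect_space T) (ell2 'I_n H) :=
  compop (Delta T) (clrange_incl (Delta T)).

Lemma Theta_series_nil Om0 (Th0 : bop (defect_space A) (defect_space B)) x :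
  Theta_series Om0 Th0 [::] x = Th0 x.
Proof.
rewrite /Theta_series fmul_const (fmul_singr_nil (T := fun i =>
  compop (component H i) (compop (Delta A) (clrange_incl (Delta A))))); last first.
  by move=> g; rewrite sum_frgen.
rewrite compop0 addr0 /fconst eqxx. by [].
Qed.

Lemma Theta_series_rcons Om0 (Th0 : bop (defect_space A) (defect_space B)) g i x :
  Theta_series Om0 Th0 (rcons g i) x = Om0 (adj (opword A (rev g)) (Delta_defect A x i)).
Proof.
rewrite /Theta_series fmul_const (fmul_singr_rcons (T := fun i =>
  compop (component H i) (compop (Delta A) (clrange_incl (Delta A))))); last first.
  by move=> g'; rewrite sum_frgen.
rewrite fgeom_adj /fconst (_ : (rcons g i == [::]) = false) ?add0r//.
by case: g.
Qed.

(** Reversal turns the first letter [i] of a word into the last factor, the one carrying the [i]-th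
    component of [Delta A]; on the remaining letters it cancels against the reversal in the
    geometric series. *)
Lemma conditionsP (Om0 : bop H (defect_space B)) (Th0 : bop (defect_space A) (defect_space B))
    (Om : bop H (fock n (defect_space B)))
    (Th : bop (fock n (defect_space A)) (fock n (defect_space B))) :
  conditions Om0 Th0 Om Th <->
  coef_conditions A B (Delta_defect A) (Delta_defect B) Om0 Th0 Om Th.
Proof.
split=> [[c1 c2 c3 [ma fr]]|[c1 c2 c3 [ma t0 ti]]].
  split=> //.
    by move=> h a; have [_ /fock_cvg_coef] := c2 h; apply.
  have Th_coef x a : Th (e_tensor (defect_space A) [::] x) a = Theta_series Om0 Th0 (rev a) x.
    by apply: inner_eq => y; rewrite fr inner_singler.
  split=> //.
    by move=> x; rewrite Th_coef Theta_series_nil.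
  by move=> x i a; rewrite Th_coef rev_cons Theta_series_rcons revK.
split=> //.
  by move=> h; apply: Omega_coef_cvg => a; exact: c2.
split=> // a x y; rewrite inner_singler.
case: a => [|i a]; first by rewrite Theta_series_nil t0.
by rewrite rev_cons Theta_series_rcons revK ti.
Qed.

End conditions.

Theorem theorem5p1 (R : realType) (n : nat) (n_gt0 : (0 < n)%N)
    (K : hilbertType R) (K_inf : infinite_dim K)
    (H : hilbertType R) (A B : 'I_n -> bop H H)
    (A_contr : row_norm A <= 1) (B_contr : row_norm B <= 1) :
  (harnack_le K A B <->
   exists (Omega0 : bop H (defect_space B))
          (Theta0 : bop (defect_space A) (defect_space B))
          (Omega : bop H (fock n (defect_space B)))
          (Theta : bop (fock n (defect_space A)) (fock n (defect_space B))),
     conditions Omega0 Theta0 Omega Theta) /\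
  (forall (Omega0 : bop H (defect_space B))
          (Theta0 : bop (defect_space A) (defect_space B))
          (Omega : bop H (fock n (defect_space B)))
          (Theta : bop (fock n (defect_space A)) (fock n (defect_space B))),
     conditions Omega0 Theta0 Omega Theta ->
     (exists! L : bop (dilation_space B) (dilation_space A), is_LBA L) /\
     forall L : bop (dilation_space B) (dilation_space A), is_LBA L ->
       forall (h : H) (xi : fock n (defect_space A)),
         adj L (h, xi) = (h, Omega h + Theta xi)).
Proof.
pose jA := dinl H (fock n (defect_space A)).
pose jB := dinl H (fock n (defect_space B)).
have LBAE L : is_LBA L <-> intertwines (dilop A_contr) (dilop B_contr) jA jB L by [].
have VA := inner_dilop_words A_contr; have WB := inner_dilop_words B_contr.
have VE : adj_dilation_shape A (Delta_defect A) (dilop A_contr) := adj_dilopE A_contr.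
have WE : adj_dilation_shape B (Delta_defect B) (dilop B_contr) := adj_dilopE B_contr.
have dB_inj : injective (Delta_defect B) := Delta_inj B_contr.
have W_dense := word_span_dense B_contr.
have LBA_of Om0 Th0 Om Th : @conditions R n H A B Om0 Th0 Om Th ->
    exists L, is_LBA L /\ forall h xi, adj L (h, xi) = (h, Om h + Th xi).
  by move=> /conditionsP/coef_conditions_entries/(entries_intertwines VE WE).
have LBA_uniq (L L' : bop (dilation_space B) (dilation_space A)) :
    is_LBA L -> is_LBA L' -> L = L'.
  by move=> /LBAE LL /LBAE; exact: (intertwines_unique W_dense LL).
split; last first.
  move=> Om0 Th0 Om Th /LBA_of[L [LL adjL]]; split.
    by exists L; split=> // L' LL'; exact: LBA_uniq.
  by move=> L' /LBA_uniq/(_ LL) ->.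
split=> [AB|[Om0 [Th0 [Om [Th /LBA_of[L [LL _]]]]]]].
  have [c c0 le_c] := harnack_word_comb VA WB AB.
  have [L LL] := intertwines_exists W_dense c0 le_c.
  have [Om [Th /(entries_coef_conditions dB_inj)/conditionsP cond]] := intertwines_entries VE WE LL.
  (* [Omega0] and [Theta0] are the vacuum components of [Om] and of [Th] on the vacuum. *)
  by eexists; eexists; exists Om, Th; exact: cond.
have VI i j x y : inner (dilop A_contr i x) (dilop A_contr j y) = (i == j)%:R * inner x y.
  exact: (inner_dilation A_contr).
have WI i j x y : inner (dilop B_contr i x) (dilop B_contr j y) = (i == j)%:R * inner x y.
  exact: (inner_dilation B_contr).
exact: (intertwines_harnack K_inf VI WI (inner_dilop_word A_contr)
  (inner_dilop_word B_contr) (proj1 (LBAE L) LL)).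
Qed.
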